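(* Let $0<p\le\infty$ and $r\in(0,1)$. Let $\{A_k\}_{k\ge 0}$ be i.i.d. complex random variables with $\mathbb{P}(A_0=0)<1$, and let $P_n(z)=\sum_{k=0}^n A_k z^k$. (i) If $\mathbb{E}[\log^+|A_0|]<\infty$, then there exists a positive random variable $X_{p,r}$ such that $$0<\lim_{n\to\infty}\frac{\|P_n'\|_{p,r}}{\|P_n\|_{p,r}}=X_{p,r}<\infty\quad\text{almost surely.}$$ (ii) If $\mathbb{E}[|A_0|]<\infty$, and for some $\varepsilon>0$ the distribution of $|A_0|$ is absolutely continuous on $[0,\varepsilon]$ with density bounded on $[0,\varepsilon]$, then $$\sup_{n\in\mathbb{N}}\mathbb{E}\left[\frac{\|P_n'\|_{p,r}}{\|P_n\|_{p,r}}\right]<\infty.$$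
   Context: For a polynomial $P$ and $r>0$, $\|P\|_{p,r}=\left(\frac{1}{2\pi}\int_0^{2\pi}|P(re^{it})|^p\,dt\right)^{1/p}$ for $0<p<\infty$, and $\|P\|_{\infty,r}=\sup_{|z|=r}|P(z)|$. $P'$ is the derivative of $P$ in $z$, and $\log^+x=\max(\log x,0)$ (with $\log^+0=0$). Convention: the ratio $\|P'\|_{p,r}/\|P\|_{p,r}$ is set equal to $0$ when $P\equiv 0$. *)

(* Defs.v *)
From HB Require Import structures.
From mathcomp Require Export all_boot all_order all_algebra.
From mathcomp Require Export complex.
From mathcomp Require Export all_classical all_reals all_analysis.

Set Implicit Arguments.
Unset Strict Implicit.
Unset Printing Implicit Defensive.

Import Order.TTheory GRing.Theory Num.Theory.
Import numFieldNormedType.Exports.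

Local Open Scope classical_set_scope.
Local Open Scope ring_scope.

(* The norm `|z| of z : R[i] lives in R[i]; this is its value in R. *)
Notation cabs := Normc.normc.

(* The Borel sigma-algebra of C, obtained by transporting the (product) Borel
   sigma-algebra of R * R along z |-> (Re z, Im z). *)
Section complex_measurable.
Variable R : realType.

Definition pair_of_complex (z : R[i]) : R * R := (complex.Re z, complex.Im z).

Definition complex_measurable : set (set R[i]) :=
  preimage_set_system setT pair_of_complex measurable.

Let complex_sigma_algebra : sigma_algebra setT complex_measurable.
Proof. exact/sigma_algebra_preimage/sigma_algebra_measurable. Qed.

Let complex_measurable0 : complex_measurable set0.
Proof. by have [] := complex_sigma_algebra. Qed.

Let complex_measurableC (B : set R[i]) :
  complex_measurable B -> complex_measurable (~` B).
Proof. by have [_ h _] := complex_sigma_algebra; rewrite -setTD; exact: h. Qed.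

Let complex_measurable_bigcup (F : (set R[i])^nat) :
  (forall k, complex_measurable (F k)) -> complex_measurable (\bigcup_k F k).
Proof. by have [_ _] := complex_sigma_algebra; apply. Qed.

HB.instance Definition _ := isPointed.Build R[i] 0.
HB.instance Definition _ := @isMeasurable.Build default_measure_display R[i]
  complex_measurable complex_measurable0 complex_measurableC
  complex_measurable_bigcup.

End complex_measurable.

Section iid.
Context d d' (T : measurableType d) (U : measurableType d') (R : realType).
Variable Pr : probability T R.

(* Mutual independence: the product rule for every finite subfamily. *)
Definition independent_RVs (X : nat -> {RV Pr >-> U}) : Prop :=
  forall (s : seq nat) (B : nat -> set U), uniq s ->
    (forall k, measurable (B k)) ->
    (Pr (\bigcap_(k in [set` s]) (X k @^-1` B k))
      = \prod_(k <- s) Pr (X k @^-1` B k))%E.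

Definition identically_distributed (X : nat -> {RV Pr >-> U}) : Prop :=
  forall (j k : nat) (B : set U), measurable B ->
    distribution Pr (X j) B = distribution Pr (X k) B.

Definition iid (X : nat -> {RV Pr >-> U}) : Prop :=
  independent_RVs X /\ identically_distributed X.

End iid.

Section norms.
Variable R : realType.
Implicit Types (p : \bar R) (r : R) (P : {poly R[i]}).

(* r e^{it} *)
Definition circle_point r (t : R) : R[i] :=
  Complex (r * cos t) (r * sin t).

(* Only 0 < p <= +oo is meaningful; the value at p = -oo is irrelevant. The
   integrand is continuous and the circle compact, so the real-valued integral
   and supremum are the genuine ones. *)
Definition circle_norm p r P : R :=
  match p with
  | s%:E => ((pi *+ 2)^-1 *
      \int[@lebesgue_measure R]_(t in `[0, pi *+ 2])
        (cabs P.[circle_point r t] `^ s)) `^ s^-1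
  | +oo%E => sup [set cabs P.[z] | z in [set z | cabs z = r]]
  | -oo%E => 0
  end.

Definition norm_ratio p r P : R :=
  if P == 0 then 0 else circle_norm p r P^`() / circle_norm p r P.

(* ln x = 0 for x <= 0 in the library, so that log^+ 0 = 0. *)
Definition log_plus (x : R) : R := Num.max (ln x) 0.

Definition random_poly (T : Type) (A : nat -> T -> R[i]) (n : nat) (w : T) :
  {poly R[i]} := \poly_(k < n.+1) A k w.

(* On [0, e], the law mu is absolutely continuous with respect to Lebesgue
   measure, with a density f bounded on [0, e]. *)
Definition ac_bounded_density_on (mu : set R -> \bar R) (e : R) : Prop :=
  exists f : R -> R,
    [/\ measurable_fun `[0, e] f,
        (forall x, x \in `[0, e] -> 0 <= f x),
        (exists M : R, forall x, x \in `[0, e] -> f x <= M) &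
        forall B : set R, measurable B -> B `<=` `[0, e] ->
          mu B = (\int[@lebesgue_measure R]_(x in B) (f x)%:E)%E].

End norms.

(* Main.v *)
Require Import Defs.
From mathcomp Require Import ring lra measurable_realfun.

Set Implicit Arguments.
Unset Strict Implicit.
Unset Printing Implicit Defensive.

Import Order.TTheory GRing.Theory Num.Theory.
Import numFieldNormedType.Exports.

Local Open Scope classical_set_scope.
Local Open Scope ring_scope.

(* Idea. The key deterministic fact is |P(0)| <= ||P||_{p,r} for every p > 0,
   including p < 1, where the norm is not convex. Over the N-th roots of unity w^j,
   the product of the |r w^j - a| is |r^N - a^N| >= |1 - r/|a|| |a|^N, so if no root
   of P lies on the circle then the product over j of the |P(r w^j)| is at least
   k |P(0)|^N with k > 0 independent of N. By AM-GM the grid average of |P|^p is at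
   least k^(p/N) |P(0)|^p; let N tend to infinity, grid averages being Riemann sums.

   (i) Borel-Cantelli gives limsup |A_k|^(1/k) <= 1, so P_n and P_n' converge
   uniformly on the circle and both norms converge; the limits are positive because
   ||P|| >= |A_k| r^k for the first nonzero coefficient A_k.

   (ii) Up to constants the ratio is at most the sum over k of
   k r^(k-1) |A_k| / max(|A_0|, |A_1|). Two small coefficients are needed in the
   denominator: 1/|A_0| alone need not be integrable, whereas independence gives
   P(max(|A_0|, |A_1|) <= 1/m) = O(1/m^2). *)

(** * Integrals over segments: bounded convergence and Riemann sums *)

Section segment_integrals.
Variable R : realType.
Local Notation mu := (@lebesgue_measure R).
Implicit Types (f g : R -> R) (a b : R).

Lemma continuous_itv_integrable g a b : continuous g ->
  mu.-integrable `[a, b] (EFin \o g).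
Proof.
move=> cg; apply: continuous_compact_integrable; first exact: segment_compact.
exact: continuous_subspaceT.
Qed.

Lemma fine_mu_itv a b : a <= b -> fine (mu `[a, b]) = b - a.
Proof.
move=> ab; rewrite lebesgue_measure_itv/= lte_fin.
case: ltgtP ab => //= -> _; by rewrite subrr.
Qed.

(** Dominated convergence with the constant [M] as dominating function, integrable on a segment;
    measurability of [f] comes from its being a pointwise limit. *)
Lemma bounded_cvg_Rintegral (f_ : nat -> R -> R) f a b (M : R) :
  (forall n, continuous (f_ n)) ->
  (forall n x, `|f_ n x| <= M) ->
  (forall x, f_ n x @[n --> \oo] --> f x) ->
  \int[mu]_(x in `[a, b]) f_ n x @[n --> \oo] --> \int[mu]_(x in `[a, b]) f x.
Proof.
move=> cf fM ff.
have mab : measurable (`[a, b]%classic : set R) by exact: measurable_itv.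
have iM : mu.-integrable `[a, b] (fun x : R => M%:E).
  exact: (@continuous_itv_integrable (cst M) a b (fun x => cvg_cst _)).
have ifn n : mu.-integrable `[a, b] (EFin \o f_ n) by exact: continuous_itv_integrable.
have ffE x : (`[a, b]%classic : set R) x -> (f_ n x)%:E @[n --> \oo] --> (f x)%:E.
  by move=> _; apply: cvg_EFin; [exact: nearW|exact: ff].
have [|||||fi _ h] := @dominated_convergence _ _ R mu _ mab
    (fun n x => (f_ n x)%:E) (fun x => (f x)%:E) (fun=> M%:E).
- by move=> n; have /integrableP[] := ifn n.
- apply: (emeasurable_fun_cvg (fun n x => (f_ n x)%:E)) => //.
  by move=> n; have /integrableP[] := ifn n.
- exact: aeW.
- exact: iM.
- by apply: aeW => x n _; rewrite lee_fin.
apply: fine_cvg; rewrite fineK//; exact: integrable_fin_num.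
Qed.

(** Heine's theorem, read off compactness in its near-covering form: around each point one
    neighbourhood serves all small [d]. Only [x] is confined to the segment. *)
Lemma segment_unif_continuous g a b (e : R) : continuous g -> 0 < e ->
  exists2 d : R, 0 < d & forall x y, x \in `[a, b] -> `|x - y| < d ->
    `|g x - g y| < e.
Proof.
move=> cg e0.
have /compact_near_coveringP cov := @segment_compact R a b.
have H : \forall d \near (0 : R)^'+, `[a, b]%classic `<=`
    (fun x => forall y, `|x - y| < d -> `|g x - g y| < e).
  apply: (cov R (0^'+) (fun d x => forall y, `|x - y| < d -> `|g x - g y| < e)).
  move=> x _.
  have /cvgrPdist_lt/(_ (e / 2)) : g y @[y --> x] --> g x by exact: cg.
  rewrite divr_gt0// => /(_ isT) /nbhs_ballP[eta /= eta0 H].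
  (* Half the radius, so that [x'] and every [y] within [d] of [x'] both stay in the ball around
     [x]. *)
  exists (ball x (eta / 2), `]0, eta / 2[%classic) => /=.
    split; first by apply/nbhs_ballP; exists (eta / 2) => //=; rewrite divr_gt0.
    by near=> d; rewrite /= in_itv/=; apply/andP; split; near: d;
      [exact: nbhs_right_gt|apply: nbhs_right_lt; rewrite divr_gt0].
  move=> [x' d] [/= xx']; rewrite in_itv/= => /andP[d0 deta] y x'y.
  have h1 : `|g x - g x'| < e / 2.
    apply: H; rewrite /ball/= in xx' *; rewrite (lt_le_trans xx')//.
    by rewrite ler_pdivrMr// ler_peMr ?ler1n// ltW.
  have h2 : `|g x - g y| < e / 2.
    apply: H; rewrite /ball/= in xx' *.
    rewrite -(subrKA x') (le_lt_trans (ler_normD _ _))// (splitr eta) ltrD//.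
    exact: lt_trans x'y deta.
  rewrite -(subrKA (g x)) (le_lt_trans (ler_normD _ _))// (splitr e) ltrD//.
  by rewrite distrC.
have [d [d0 Hd]] : exists d : R, 0 < d /\
    `[a, b] `<=` (fun x => forall y, `|x - y| < d -> `|g x - g y| < e).
  near (0 : R)^'+ => d; exists d; split; near: d => //; exact: nbhs_right_gt.
by exists d => // x y xab; apply: Hd.
Unshelve. all: by end_near. Qed.

Lemma Rintegral_left_endpoint g a b (e : R) : continuous g -> a <= b ->
  (forall x, x \in `[a, b] -> `|g x - g a| <= e) ->
  `|\int[mu]_(x in `[a, b]) g x - (b - a) * g a| <= (b - a) * e.
Proof.
move=> cg ab ge.
have mab : measurable (`[a, b]%classic : set (measurableTypeR R)).
  exact: measurable_itv.
have ic (c : R) : mu.-integrable `[a, b] (EFin \o cst c).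
  by apply: continuous_itv_integrable => x; exact: cvg_cst.
have ig := continuous_itv_integrable a b cg.
have cgB : continuous (fun x => g x - g a).
  by move=> x; apply: cvgB; [exact: cg|exact: cvg_cst].
have := Rintegral_cst mu mab (g a); rewrite fine_mu_itv// mulrC => <-.
have := Rintegral_cst mu mab e; rewrite fine_mu_itv// mulrC => <-.
rewrite -RintegralB//; last exact: ic.
apply: (le_trans (le_normr_Rintegral mab _)).
  exact: continuous_itv_integrable.
apply: le_Rintegral => //; last exact: ic.
apply: (@continuous_itv_integrable (fun x => `|g x - g a|)) => x.
by apply: cvg_norm; exact: cgB.
Qed.

Lemma Rintegral_itv_cat g a b c : continuous g -> a <= b -> b <= c ->
  \int[mu]_(x in `[a, c]) g x =
  \int[mu]_(x in `[a, b]) g x + \int[mu]_(x in `[b, c]) g x.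
Proof.
move=> cg ab bc.
have := @Rintegral_itvB R g (BLeft a) (BRight c) b
  (continuous_itv_integrable a c cg).
rewrite !bnd_simp => /(_ ab bc) /eqP; rewrite subr_eq addrC => /eqP ->.
congr (_ + _); rewrite Rintegral_itv_obnd_cbnd//.
apply: (integrableS _ _ _ (continuous_itv_integrable b c cg)) => //.
exact: subset_itv_oc_cc.
Qed.

Lemma riemann_sum_cvg g (L : R) : continuous g -> 0 <= L ->
  L / n.+1%:R * \sum_(0 <= j < n.+1) g (j%:R * (L / n.+1%:R)) @[n --> \oo]
    --> \int[mu]_(x in `[0, L]) g x.
Proof.
move=> cg L0; apply/cvgrPdist_le => e e0.
(* Dividing by [L + 1] covers [L = 0]; the total error is then [L * (e / (L + 1)) <= e]. *)
have e'0 : 0 < e / (L + 1) by rewrite divr_gt0// ltr_pwDr.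
have [d d0 Hd] := @segment_unif_continuous g 0 L _ cg e'0.
near=> n; set h := L / n.+1%:R.
have hd : h < d.
  rewrite /h ltr_pdivrMr// mulrC -ltr_pdivrMr//; near: n.
  by apply: filterS (nbhs_infty_gtr (L / d)) => m /lt_le_trans; apply; rewrite ler_nat.
have h0 : 0 <= h by rewrite divr_ge0.
have hL : n.+1%:R * h = L by rewrite mulrC divfK.
(* Induction on the number of cells: each adds an error of at most its length [h] times the
   tolerance. *)
suff H k : (k <= n.+1)%N ->
    `|\int[mu]_(x in `[0, k%:R * h]) g x - h * \sum_(0 <= j < k) g (j%:R * h)|
     <= k%:R * (h * (e / (L + 1))).
  have := H _ (leqnn n.+1); rewrite hL => /le_trans; apply.
  rewrite mulrA hL mulrCA ler_piMr// ?(ltW e0)//.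
  by rewrite ler_pdivrMr ?mul1r ?lerDl// ltr_pwDr.
elim: k => [_|k IH kn].
  by rewrite mul0r set_itv1 Rintegral_set1 big_nil mulr0 subr0 normr0 mul0r.
have kk : k%:R * h <= k.+1%:R * h by rewrite ler_wpM2r// ler_nat.
have kh0 : 0 <= k%:R * h by rewrite mulr_ge0.
have hE : k.+1%:R * h - k%:R * h = h by rewrite -mulrBl -natrB// subSnn mul1r.
rewrite (@Rintegral_itv_cat g 0 (k%:R * h))// big_nat_recr//= mulrDr opprD addrACA.
rewrite (le_trans (ler_normD _ _))//.
rewrite -[leRHS](_ : k%:R * (h * (e / (L + 1))) + h * (e / (L + 1)) = _); last first.
  by rewrite -[k.+1%:R]natr1 mulrDl mul1r.
rewrite lerD ?IH ?(ltnW kn)//.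
have := @Rintegral_left_endpoint g (k%:R * h) (k.+1%:R * h) (e / (L + 1)) cg kk.
rewrite hE; apply => x.
rewrite in_itv/= => /andP[kx xk].
rewrite distrC; apply/ltW/Hd.
  rewrite in_itv/= kh0/= -hL ler_wpM2r// ler_nat ltnW//.
by rewrite distrC ger0_norm ?subr_ge0// (le_lt_trans _ hd)// -[leRHS]hE lerB.
Unshelve. all: by end_near. Qed.

End segment_integrals.

(** * The modulus, points of a circle and roots of unity *)

Section complex_modulus.
Variable R : realType.
Implicit Types (x y z : R[i]).

Lemma cabs_normr z : `|z| = (cabs z)%:C%C.
Proof. by rewrite normc_def; case: z. Qed.

Lemma cabs_ge0 z : 0 <= cabs z.
Proof. by case: z => a b; exact: sqrtr_ge0. Qed.

Lemma cabs0 : cabs (0 : R[i]) = 0. Proof. exact: Normc.normc0. Qed.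

Lemma cabs1 : cabs (1 : R[i]) = 1. Proof. exact: Normc.normc1. Qed.

Lemma cabs_eq0 z : (cabs z == 0) = (z == 0).
Proof.
apply/idP/idP => [/eqP/Normc.eq0_normc ->//|/eqP ->]; by rewrite cabs0.
Qed.

Lemma cabs_gt0 z : (0 < cabs z) = (z != 0).
Proof. by rewrite lt_def cabs_ge0 andbT cabs_eq0. Qed.

Lemma cabsM x y : cabs (x * y) = cabs x * cabs y.
Proof. exact: Normc.normcM. Qed.

Lemma cabsX z n : cabs (z ^+ n) = cabs z ^+ n.
Proof. by elim: n => [|n IH]; rewrite ?expr0 ?cabs1// !exprS cabsM IH. Qed.

Lemma cabsN z : cabs (- z) = cabs z.
Proof. by apply/(@complexI R); rewrite -!cabs_normr normrN. Qed.

Lemma cabsD x y : cabs (x + y) <= cabs x + cabs y.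
Proof. by rewrite -lecR rmorphD/= -!cabs_normr ler_normD. Qed.

Lemma cabsC x y : cabs (x - y) = cabs (y - x).
Proof. by rewrite -opprB cabsN. Qed.

Lemma cabs_dist x y : `|cabs x - cabs y| <= cabs (x - y).
Proof.
have H (u v : R[i]) : cabs u - cabs v <= cabs (u - v).
  by rewrite lerBlDr; have := cabsD (u - v) v; rewrite subrK.
by rewrite ler_norml H andbT lerNl opprB cabsC H.
Qed.

Lemma cabs_nat n : cabs (n%:R : R[i]) = n%:R.
Proof. by apply/(@complexI R); rewrite -cabs_normr normr_nat rmorph_nat. Qed.

Lemma cabs_real (a : R) : 0 <= a -> cabs a%:C%C = a.
Proof. by move=> a0; rewrite /= expr0n addr0 sqrtr_sqr ger0_norm. Qed.

Lemma cabs_prod (I : Type) (s : seq I) (F : I -> R[i]) :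
  cabs (\prod_(i <- s) F i) = \prod_(i <- s) cabs (F i).
Proof. exact: (big_morph _ cabsM cabs1). Qed.

Lemma cabs_sum (I : Type) (s : seq I) (F : I -> R[i]) :
  cabs (\sum_(i <- s) F i) <= \sum_(i <- s) cabs (F i).
Proof.
elim/big_ind2 : _ => //; first by rewrite cabs0.
by move=> x a y b xa yb; rewrite (le_trans (cabsD _ _))// lerD.
Qed.

Lemma ReMD x y z : complex.Re (x * y + z) =
  complex.Re x * complex.Re y - complex.Im x * complex.Im y + complex.Re z.
Proof. by case: x y z => [? ?] [? ?] []. Qed.

Lemma ImMD x y z : complex.Im (x * y + z) =
  complex.Re x * complex.Im y + complex.Im x * complex.Re y + complex.Im z.
Proof. by case: x y z => [? ?] [? ?] []. Qed.

(** Continuity of |P(z)| phrased through real and imaginary parts, so that only real limits occur;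
    Horner's scheme drives the induction on [P]. *)
Lemma horner_cabs_cvg (U : Type) (F : set_system U) (FF : Filter F)
    (z : U -> R[i]) (l : R[i]) (P : {poly R[i]}) :
  complex.Re (z u) @[u --> F] --> complex.Re l ->
  complex.Im (z u) @[u --> F] --> complex.Im l ->
  cabs P.[z u] @[u --> F] --> cabs P.[l].
Proof.
move=> rz iz.
have [rP iP] : complex.Re P.[z u] @[u --> F] --> complex.Re P.[l] /\
    complex.Im P.[z u] @[u --> F] --> complex.Im P.[l].
  elim/poly_ind: P => [|P c [IHr IHi]].
    by rewrite horner0; split; under eq_fun do rewrite horner0; exact: cvg_cst.
  split; rewrite hornerMXaddC; under eq_fun do rewrite hornerMXaddC.
    rewrite ReMD; under eq_fun do rewrite ReMD.
    by apply: cvgD; [apply: cvgB; apply: cvgM|exact: cvg_cst].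
  rewrite ImMD; under eq_fun do rewrite ImMD.
  by apply: cvgD; [apply: cvgD; apply: cvgM|exact: cvg_cst].
have cE (w : R[i]) : cabs w = Num.sqrt (complex.Re w ^+ 2 + complex.Im w ^+ 2) by case: w.
rewrite cE; under eq_fun do rewrite cE.
apply: continuous_cvg; first exact: sqrt_continuous.
by rewrite !expr2; under eq_fun do rewrite !expr2; apply: cvgD; apply: cvgM.
Qed.

Lemma cabs_circle_point (r t : R) : 0 <= r -> cabs (circle_point r t) = r.
Proof.
by move=> r0; rewrite /= !exprMn -mulrDr cos2Dsin2 mulr1 sqrtr_sqr ger0_norm.
Qed.

Lemma circle_pointM (r r' t t' : R) :
  circle_point r t * circle_point r' t' = circle_point (r * r') (t + t').
Proof.
apply/eqP; rewrite eq_complex/= cosD sinD; apply/andP; split; apply/eqP; ring.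
Qed.

Lemma circle_pointX (t : R) n :
  circle_point 1 t ^+ n = circle_point 1 (n%:R * t).
Proof.
elim: n => [|n IH].
  by rewrite expr0 mul0r /circle_point cos0 sin0 mulr1 mulr0.
by rewrite exprS IH circle_pointM mulr1 -natr1 mulrDl mul1r addrC.
Qed.

(** The angle is [acos (a / r)] or its opposite: the imaginary part is known up to sign from its
    square, and the sign of the angle settles it. *)
Lemma circle_point_surj (r : R) z : 0 < r -> cabs z = r ->
  exists t, z = circle_point r t.
Proof.
case: z => a b r0 /= abr.
have r2 : a ^+ 2 + b ^+ 2 = r ^+ 2.
  by rewrite -abr sqr_sqrtr// addr_ge0 ?sqr_ge0.
have ar1 : -1 <= a / r <= 1.
  rewrite -ler_norml -(@expr_le1 _ 2)// real_normK ?num_real//.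
  rewrite exprMn exprVn ler_pdivrMr ?exprn_gt0// mul1r -r2.
  by rewrite lerDl sqr_ge0.
have s2 : (r * sin (acos (a / r))) ^+ 2 = b ^+ 2.
  rewrite exprMn sin2cos2 acosK ?in_itv// exprMn exprVn.
  by rewrite mulrBr mulr1 mulrCA divff ?mulr1 ?expf_neq0 ?gt_eqF// -r2 addrC addKr.
have ca : r * cos (acos (a / r)) = a.
  by rewrite acosK ?in_itv// mulrC divfK// gt_eqF.
move/eqP : s2; rewrite eqf_sqr => /orP[|] /eqP sb.
- by exists (acos (a / r)); rewrite /circle_point ca sb.
- by exists (- acos (a / r)); rewrite /circle_point cosN sinN ca mulrN sb opprK.
Qed.

(** If a power with exponent strictly between 0 and N = [n.+1] were 1, then cos(2 pi x) = 1 for some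
    x in (0, 1), forcing sin(pi x) = 0, whereas the sine is positive on (0, pi). *)
Lemma circle_point_prim_root n :
  n.+1.-primitive_root (circle_point (1 : R) (pi *+ 2 / n.+1%:R)).
Proof.
rewrite /primitive_root_of_unity /=; apply/forallP => i; apply/eqP.
rewrite unity_rootE circle_pointX mulrCA.
have [->|iN] := eqVneq i.+1 n.+1.
  by rewrite divff ?pnatr_eq0// mulr1 /circle_point cos2pi sin2pi mulr1 mulr0 eqxx.
apply/negbTE/negP => /eqP[+ _]; rewrite mul1r.
set x : R := i.+1%:R / n.+1%:R.
have x0 : 0 < x by rewrite divr_gt0.
have x1 : x < 1.
  by rewrite ltr_pdivrMr// mul1r ltr_nat ltn_neqAle iN ltn_ord.
have -> : pi *+ 2 * x = (x * pi) *+ 2 by rewrite mulrC mulrnAr.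
move=> c1.
have : 0 < sin (x * pi).
  by rewrite sin_gt0_pi// mulr_gt0 ?pi_gt0//= gtr_pMl ?pi_gt0.
suff -> : sin (x * pi) = 0 by rewrite ltxx.
move: c1; rewrite cos_mulr2n => c1.
have := sin2cos2 (x * pi).
have -> : cos (x * pi) ^+ 2 = 1 by lra.
by rewrite subrr => /eqP; rewrite sqrf_eq0 => /eqP.
Qed.

End complex_modulus.

(** * A Jensen-type lower bound for circle means, by AM-GM over roots of unity *)

Section jensen.
Variable R : realType.
Local Notation mu := (@lebesgue_measure R).
Implicit Types (P : {poly R[i]}) (r s : R).

(** For [l > 0] the power is exp(s ln x) near [l]; at [l = 0] the logarithm is of no help, and
    closeness [e] is obtained from the threshold e^(1/s). *)
Lemma powR_cvg (U : Type) (F : set_system U) (FF : Filter F) (f : U -> R)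
    (l s : R) : 0 < s -> (forall u, 0 <= f u) -> 0 <= l ->
  f u @[u --> F] --> l -> f u `^ s @[u --> F] --> l `^ s.
Proof.
move=> s0 f0; rewrite le_eqVlt => /predU1P[<-|l0] fl.
  rewrite powR0 ?gt_eqF//; apply/cvgrPdist_lt => e e0.
  move/cvgrPdist_lt : fl => /(_ (e `^ s^-1)); rewrite powR_gt0// => /(_ isT).
  apply: filterS => u; rewrite !sub0r !normrN !ger0_norm ?powR_ge0// => fe.
  have := @gt0_ltr_powR _ s s0 _ _ (f0 u) (powR_ge0 e s^-1) fe.
  by rewrite -powRrM mulVf ?gt_eqF// powRr1// ltW.
have -> : l `^ s = expR (s * ln l) by rewrite /powR gt_eqF.
have h : expR (s * ln (f u)) @[u --> F] --> expR (s * ln l).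
  apply: continuous_cvg; first exact: continuous_expR.
  by apply: cvgMl_tmp; apply: continuous_cvg => //; exact: continuous_ln.
apply: cvg_trans h; apply: near_eq_cvg.
move/cvgrPdist_lt : fl => /(_ l l0); apply: filterS => u fl.
have fu0 : 0 < f u by move: fl; rewrite ltr_distlC subrr => /andP[].
by rewrite /powR gt_eqF.
Qed.

(** The [s]-th power of the norm with exponent [s]; estimates are made here and the root is taken at
    the end. *)
Definition circle_mean s r P : R := (pi *+ 2)^-1 *
  \int[mu]_(t in `[0, pi *+ 2]) (cabs P.[circle_point r t] `^ s).

Lemma circle_mean_ge0 s r P : 0 <= circle_mean s r P.
Proof.
apply: mulr_ge0; first by rewrite invr_ge0 mulrn_wge0// pi_ge0.
by apply: Rintegral_ge0 => t _; exact: powR_ge0.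
Qed.

Lemma circle_powR_continuous s r P : 0 < s ->
  continuous (fun t => cabs P.[circle_point r t] `^ s).
Proof.
move=> s0 t; apply: powR_cvg => //.
- by move=> u; exact: cabs_ge0.
- exact: cabs_ge0.
apply: horner_cabs_cvg => /=; apply: cvgMl_tmp.
- exact: continuous_cos.
- exact: continuous_sin.
Qed.

Lemma circle_mean_grid_cvg s r P : 0 < s ->
  n.+1%:R^-1 * \sum_(0 <= j < n.+1)
    cabs P.[circle_point r (j%:R * (pi *+ 2 / n.+1%:R))] `^ s
    @[n --> \oo] --> circle_mean s r P.
Proof.
move=> s0; have pi2 : 0 < pi *+ 2 :> R by rewrite mulrn_wgt0 ?pi_gt0.
have := @riemann_sum_cvg R _ (pi *+ 2) (@circle_powR_continuous s r P s0) (ltW pi2).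
move=> /(cvgM (cvg_cst ((pi *+ 2)^-1))); apply: cvg_trans; apply: near_eq_cvg.
by apply: nearW => n /=; rewrite !mulrA mulVf ?gt_eqF// mul1r.
Qed.

(** The factorisation of X^N - 1 over the N-th roots of unity, N = [n.+1], is evaluated at a/r and
    multiplied by r^N. *)
Lemma prod_grid_dist (r : R) n (a : R[i]) : 0 < r ->
  \prod_(0 <= j < n.+1)
    cabs (circle_point r (j%:R * (pi *+ 2 / n.+1%:R)) - a) =
  cabs (r%:C%C ^+ n.+1 - a ^+ n.+1).
Proof.
move=> r0; set w := circle_point (1 : R) (pi *+ 2 / n.+1%:R).
have rC0 : r%:C%C != 0 :> R[i] by rewrite -cabs_gt0 cabs_real ?ltW.
have := factor_Xn_sub_1 (@circle_point_prim_root R n).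
move=> /(congr1 (fun p : {poly R[i]} => p.[a / r%:C%C])).
rewrite hornerD hornerN hornerXn hornerC horner_prod => H.
rewrite cabsC; have -> : a ^+ n.+1 - r%:C%C ^+ n.+1 =
    r%:C%C ^+ n.+1 * \prod_(0 <= j < n.+1) ('X - (w ^+ j)%:P).[a / r%:C%C].
  by rewrite H mulrBr mulr1 -exprMn mulrC divfK.
rewrite cabsM cabs_prod cabsX cabs_real ?ltW//.
have -> : r ^+ n.+1 = \prod_(0 <= j < n.+1) r by rewrite prodr_const_nat subn0.
rewrite -big_split/=; apply: eq_bigr => j _.
rewrite hornerXsubC circle_pointX.
have -> : circle_point r (j%:R * (pi *+ 2 / n.+1%:R)) =
    r%:C%C * circle_point 1 (j%:R * (pi *+ 2 / n.+1%:R)).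
  by apply/eqP; rewrite eq_complex/= !mul1r !mul0r subr0 addr0 !eqxx.
rewrite cabsC -[X in _ = X * _](cabs_real (ltW r0)) -cabsM mulrBr.
by rewrite [r%:C%C * (a / _)]mulrC divfK.
Qed.

(** The quotient of the two sides is a geometric sum with first term 1 and nonnegative terms. *)
Lemma dist1X_ge (x : R) n : 0 <= x -> `|1 - x| <= `|1 - x ^+ n.+1|.
Proof.
move=> x0; have -> : 1 - x ^+ n.+1 = (1 - x) * \sum_(i < n.+1) x ^+ i.
  by rewrite -opprB subrX1 -mulNr opprB.
rewrite normrM ler_peMr// ger0_norm ?sumr_ge0// => [|i _]; last exact: exprn_ge0.
by rewrite big_ord_recl expr0 lerDl sumr_ge0// => i _; exact: exprn_ge0.
Qed.

(** The factor |1 - r/|a|| is free of [n], and it is positive exactly when |a| differs from [r]. *)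
Lemma prod_grid_dist_ge (r : R) n (a : R[i]) : 0 < r -> a != 0 ->
  `|1 - r / cabs a| * cabs a ^+ n.+1 <= \prod_(0 <= j < n.+1)
    cabs (circle_point r (j%:R * (pi *+ 2 / n.+1%:R)) - a).
Proof.
move=> r0 a0; rewrite prod_grid_dist//.
have ca : 0 < cabs a by rewrite cabs_gt0.
apply: (@le_trans _ _ (`|1 - (r / cabs a) ^+ n.+1| * cabs a ^+ n.+1)).
  by rewrite ler_wpM2r ?exprn_ge0 ?cabs_ge0// dist1X_ge// divr_ge0// ltW.
rewrite cabsC; apply: le_trans (cabs_dist _ _).
rewrite !cabsX cabs_real ?(ltW r0)//.
have -> : cabs a ^+ n.+1 - r ^+ n.+1 = (1 - (r / cabs a) ^+ n.+1) * cabs a ^+ n.+1.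
  by rewrite mulrBl mul1r -exprMn divfK// gt_eqF.
by rewrite normrM [X in _ <= _ * X]ger0_norm// exprn_ge0// ltW.
Qed.

(** Splitting [P] into linear factors treats one root at a time: [k] is the product of the |1 -
    r/|a|| over the roots, and the leading coefficient and the |a| reassemble into |P(0)|. *)
Lemma prod_grid_horner_ge P (r : R) : 0 < r -> P.[0] != 0 ->
    (forall z, root P z -> cabs z != r) ->
  exists2 k : R, 0 < k & forall n, k * cabs P.[0] ^+ n.+1 <=
    \prod_(0 <= j < n.+1)
      cabs P.[circle_point r (j%:R * (pi *+ 2 / n.+1%:R))].
Proof.
move=> r0 P0 rP; have [rs PE] := closed_field_poly_normal P.
have PN0 : lead_coef P != 0.
  by rewrite lead_coef_eq0; apply: contraNneq P0 => ->; rewrite horner0.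
have rsP a : a \in rs -> a != 0 /\ cabs a != r.
  move=> ars; have rPa : root P a by rewrite PE rootZ// root_prod_XsubC.
  split; last exact: rP.
  by apply: contraNneq P0 => a0; move: rPa; rewrite a0 => /rootP ->.
have cP z : cabs P.[z] = cabs (lead_coef P) * \prod_(a <- rs) cabs (z - a).
  rewrite {1}PE hornerZ cabsM horner_prod cabs_prod; congr (_ * _).
  by apply: eq_bigr => a _; rewrite hornerXsubC.
exists (\prod_(a <- rs) `|1 - r / cabs a|).
  rewrite big_seq prodr_gt0// => a /rsP[a0 ar].
  rewrite normr_gt0 subr_eq0 eq_sym; apply: contra ar => /eqP.
  by move=> /(canRL (divfK _)); rewrite cabs_eq0 mul1r => ->.
move=> n; rewrite (eq_bigr _ (fun j _ => cP _)) big_split/= prodr_const_nat subn0.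
rewrite exchange_big/= cP exprMn mulrCA ler_wpM2l ?exprn_ge0 ?cabs_ge0//.
rewrite -prodrXl -big_split/= !big_seq; apply: ler_prod => a /rsP[a0 _].
rewrite sub0r cabsN mulr_ge0 ?exprn_ge0 ?cabs_ge0//=.
exact: prod_grid_dist_ge.
Qed.

Lemma powR_prod (s : R) n (F : nat -> R) : (forall j, 0 <= F j) ->
  (\prod_(0 <= j < n) F j) `^ s = \prod_(0 <= j < n) F j `^ s.
Proof.
move=> F0; elim: n => [|n IH]; first by rewrite !big_nil powR1.
by rewrite !big_nat_recr//= powRM ?IH ?prodr_ge0.
Qed.

(** By AM-GM the average over N grid points is at least the geometric mean, hence at least k^(s/N)
    |P(0)|^s; then N tends to infinity. *)
Lemma circle_mean_ge_nonroot P s r : 0 < s -> 0 < r ->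
  (forall z, root P z -> cabs z != r) -> cabs P.[0] `^ s <= circle_mean s r P.
Proof.
move=> s0 r0 rP; have [->|P0] := eqVneq P.[0] 0.
  by rewrite cabs0 powR0 ?gt_eqF// circle_mean_ge0.
have [k k0 kP] := prod_grid_horner_ge r0 P0 rP.
(* The factor k^(s/N) tends to 1, its logarithm being a constant divided by N. *)
have kcvg : (k `^ s) `^ (n.+1%:R^-1) * cabs P.[0] `^ s @[n --> \oo] -->
    (1 : R) * cabs P.[0] `^ s.
  apply: cvgM; last exact: cvg_cst.
  have q0 : 0 < k `^ s by exact: powR_gt0.
  set q := k `^ s in q0 *.
  have -> : (fun n => q `^ n.+1%:R^-1) = (fun n => expR (n.+1%:R^-1 * ln q)).
    by apply/funext => n; rewrite /powR gt_eqF.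
  have q1 : 1 = expR (0 * ln q) by rewrite mul0r expR0.
  rewrite [X in _ --> X]q1.
  apply: continuous_cvg; first exact: continuous_expR.
  exact: (cvgM (@cvg_harmonic R) (cvg_cst (ln q))).
rewrite -[leLHS]mul1r -(cvg_lim _ kcvg)//.
rewrite -(cvg_lim _ (@circle_mean_grid_cvg s r P s0))//.
apply: ler_lim.
- by apply/cvg_ex; eexists; exact: kcvg.
- by apply/cvg_ex; eexists; exact: circle_mean_grid_cvg.
apply: nearW => n; set m := (X in _ <= X).
have m0 : 0 <= m.
  by rewrite /m mulr_ge0// sumr_ge0// => j _; exact: powR_ge0.
(* Comparing N-th powers allows AM-GM in the form: product at most the N-th power of the mean
   [m]. *)
suff : k `^ s * (cabs P.[0] `^ s) ^+ n.+1 <= m ^+ n.+1.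
  move=> H; have := @ge0_ler_powR _ (n.+1%:R^-1 : R) _ _ _ _ _ H.
  rewrite !nnegrE invr_ge0 ler0n exprn_ge0// mulr_ge0 ?exprn_ge0 ?powR_ge0//.
  move=> /(_ isT isT isT).
  rewrite powRM ?powR_ge0 ?exprn_ge0 ?powR_ge0//.
  have e (x : R) : 0 <= x -> (x ^+ n.+1) `^ (n.+1%:R^-1) = x.
    by move=> x0; rewrite -powR_mulrn// -powRrM divff ?powRr1// pnatr_eq0.
  by rewrite !e// powR_ge0.
have : \prod_(0 <= j < n.+1)
    cabs P.[circle_point r (j%:R * (pi *+ 2 / n.+1%:R))] `^ s <= m ^+ n.+1.
  rewrite /m !big_mkord [_^-1 * _]mulrC.
  have := @leif_AGM R 'I_n.+1 predT
    (fun j => cabs P.[circle_point r (j%:R * (pi *+ 2 / n.+1%:R))] `^ s).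
  by rewrite card_ord => /(_ (fun _ _ => powR_ge0 _ _)) [+ _].
apply: le_trans.
rewrite -powR_prod; last by move=> j; exact: cabs_ge0.
rewrite -(powR_mulrn n.+1 (powR_ge0 _ _)) powRAC powR_mulrn ?cabs_ge0//.
rewrite -powRM ?exprn_ge0 ?cabs_ge0 ?(ltW k0)//.
apply: ge0_ler_powR; [exact: ltW| | |exact: kP]; rewrite nnegrE.
  by rewrite mulr_ge0 ?exprn_ge0 ?cabs_ge0 ?(ltW k0).
by rewrite prodr_ge0// => j _; exact: cabs_ge0.
Qed.

End jensen.

(** * Lower bounds of circle norms by the first coefficients, for every exponent *)

Section circle_norms.
Variable R : realType.
Local Notation mu := (@lebesgue_measure R).
Implicit Types (P Q : {poly R[i]}) (r s : R) (p : \bar R).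

(** Radius and polynomial both vary, so that one statement serves shrinking radii as well as partial
    sums of a series. *)
Lemma circle_mean_cvg s (P_ : nat -> {poly R[i]}) (r_ : nat -> R) (g : R -> R)
    (M : R) : 0 < s ->
  (forall n t, cabs (P_ n).[circle_point (r_ n) t] <= M) ->
  (forall t, cabs (P_ n).[circle_point (r_ n) t] @[n --> \oo] --> g t) ->
  circle_mean s (r_ n) (P_ n) @[n --> \oo] -->
    (pi *+ 2)^-1 * \int[mu]_(t in `[0, pi *+ 2]) (g t `^ s).
Proof.
move=> s0 PM Pg; apply: cvgMl_tmp.
have M0 : 0 <= M := le_trans (cabs_ge0 _) (PM 0%N 0).
apply: (@bounded_cvg_Rintegral R _ _ _ _ (M `^ s)).
- by move=> n; exact: circle_powR_continuous.
- move=> n t; rewrite ger0_norm ?powR_ge0//.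
  by apply: ge0_ler_powR; rewrite ?nnegrE ?cabs_ge0// ltW.
- move=> t; apply: powR_cvg => //; first by move=> n; exact: cabs_ge0.
  move: (Pg t) => /cvg_lim <-//; apply: limr_ge.
    by apply/cvg_ex; exists (g t); exact: Pg.
  by apply: nearW => n; exact: cabs_ge0.
Qed.

Lemma cabs_horner_le P (z : R[i]) (rho : R) : cabs z <= rho ->
  cabs P.[z] <= \sum_(i < size P) cabs P`_i * rho ^+ i.
Proof.
move=> zr; rewrite horner_coef; apply: le_trans (cabs_sum _ _) _.
apply: ler_sum => i _; rewrite cabsM cabsX ler_wpM2l ?cabs_ge0//.
by rewrite lerXn2r// nnegrE ?cabs_ge0// (le_trans (cabs_ge0 _) zr).
Qed.

(** An element equal to [l] is avoided by hypothesis, and any other stays at positive distance from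
    the tail of the sequence; the list is finite. *)
Lemma roots_avoid_cvg (rs : seq R) (x : nat -> R) (l : R) :
  x n @[n --> \oo] --> l -> (forall n, x n != l) ->
  \forall n \near \oo, forall a, a \in rs -> a != x n.
Proof.
move=> xl xNl; elim: rs => [|b rs IH]; first by apply: nearW => n a.
have [bl|bl] := eqVneq b l.
  apply: filterS IH => n H a; rewrite inE => /predU1P[->|]; last exact: H.
  by rewrite bl eq_sym.
have h : \forall n \near \oo, x n - b != 0.
  apply: (@cvgr_neq0 _ _ _ _ _ _ (l - b)); last by rewrite subr_eq0 eq_sym.
  by apply: cvgB => //; exact: cvg_cst.
apply: filterS2 IH h => n H xb a; rewrite inE => /predU1P[->|]; last exact: H.
by rewrite eq_sym -subr_eq0.
Qed.

(* When a root of P lies on the circle, shrink the radius slightly. *)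
Lemma circle_mean_ge P s r : 0 < s -> 0 < r ->
  cabs P.[0] `^ s <= circle_mean s r P.
Proof.
move=> s0 r0; have [->|P0] := eqVneq P 0.
  by rewrite horner0 cabs0 powR0 ?gt_eqF// circle_mean_ge0.
have [rs PE] := closed_field_poly_normal P.
(* The denominator starts at 2, which keeps every radius positive and strictly below [r]. *)
pose r_ n : R := r - r * n.+2%:R^-1.
have r_lt n : r_ n < r by rewrite /r_ ltrBlDr ltrDl mulr_gt0.
have r_gt n : 0 < r_ n.
  by rewrite /r_ subr_gt0 gtr_pMr// invf_lt1 ?ltr1n// ltr0n.
have r_cvg : r_ n @[n --> \oo] --> r.
  have rE : r = r - r * 0 by rewrite mulr0 subr0.
  rewrite [X in _ --> X]rE.
  apply: cvgB; first exact: cvg_cst.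
  apply: cvgMl_tmp; by have := @cvg_harmonic R; rewrite -cvg_shiftS.
have h := @circle_mean_cvg s (fun=> P) r_ (fun t => cabs P.[circle_point r t])
  (\sum_(i < size P) cabs P`_i * r ^+ i) s0.
have {h} : circle_mean s (r_ n) P @[n --> \oo] --> circle_mean s r P.
  apply: h => [n t|t].
    by apply: cabs_horner_le; rewrite cabs_circle_point ltW.
  by apply: horner_cabs_cvg => /=; apply: cvgMr_tmp.
move=> h; rewrite -(cvg_lim _ h)//; apply: limr_ge.
  by apply/cvg_ex; eexists; exact: h.
have := @roots_avoid_cvg [seq cabs a | a <- rs] r_ r r_cvg (fun n => negbT (lt_eqF (r_lt n))).
apply: filterS => n H; apply: circle_mean_ge_nonroot => // z.
rewrite PE rootZ ?lead_coef_eq0// root_prod_XsubC => zrs.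
by apply: H; apply/mapP; exists z.
Qed.

Lemma circle_sup_has_ub r P :
  has_ubound [set cabs P.[z] | z in [set z | cabs z = r]].
Proof.
exists (\sum_(i < size P) cabs P`_i * r ^+ i) => _ [z /= zr <-].
by apply: cabs_horner_le; rewrite zr.
Qed.

Lemma circle_norm_ge0 p r P : 0 <= circle_norm p r P.
Proof.
case: p => [s| |] //=; first exact: powR_ge0.
(* For negative [r] the circle is empty and the supremum takes the default value 0. *)
set S := (X in sup X); have [->|/set0P[x Sx]] := eqVneq S set0; first by rewrite sup0.
apply: (@le_trans _ _ x); first by case: Sx => z _ <-; exact: cabs_ge0.
by apply: ub_le_sup => //; exact: circle_sup_has_ub.
Qed.

Lemma circle_mean_le s r P (M : R) : 0 < s -> 0 <= r ->
  (forall z, cabs z = r -> cabs P.[z] <= M) -> circle_mean s r P <= M `^ s.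
Proof.
move=> s0 r0 PM; have pi2 : 0 < pi *+ 2 :> R by rewrite mulrn_wgt0 ?pi_gt0.
rewrite ler_pdivrMl//.
have mD : measurable (`[0, pi *+ 2]%classic : set (measurableTypeR R)).
  exact: measurable_itv.
have := Rintegral_cst mu mD (M `^ s); rewrite fine_mu_itv ?(ltW pi2)// subr0.
rewrite mulrC => <-; apply: le_Rintegral => //.
- by apply: continuous_itv_integrable; exact: circle_powR_continuous.
- apply: (@continuous_itv_integrable _ (cst (M `^ s))) => x; exact: cvg_cst.
move=> t _; have M0 := le_trans (cabs_ge0 _) (PM _ (cabs_circle_point 0 r0)).
apply: ge0_ler_powR; rewrite ?nnegrE ?cabs_ge0// ?(ltW s0)//.
by apply: PM; exact: cabs_circle_point.
Qed.

Lemma circle_normE s r P : circle_norm s%:E r P = circle_mean s r P `^ s^-1.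
Proof. by []. Qed.

Lemma powR_root s (x : R) : 0 < s -> 0 <= x -> (x `^ s) `^ s^-1 = x.
Proof. by move=> s0 x0; rewrite -powRrM divff ?powRr1// gt_eqF. Qed.

Lemma ler_powR_pos s (x y : R) : 0 < s -> 0 <= x -> x <= y -> x `^ s <= y `^ s.
Proof.
move=> s0 x0 xy; apply: ge0_ler_powR => //; rewrite ?nnegrE//; first exact: ltW.
exact: le_trans xy.
Qed.

Lemma circle_norm_le p r P (M : R) : (0 < p)%E -> 0 <= r ->
  (forall z, cabs z = r -> cabs P.[z] <= M) -> circle_norm p r P <= M.
Proof.
move=> p0 r0 PM; have M0 := le_trans (cabs_ge0 _) (PM _ (cabs_circle_point 0 r0)).
case: p p0 => [s|_|]; last by [].
  rewrite lte_fin => s0; rewrite circle_normE -[leRHS](powR_root s0 M0).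
  apply: ler_powR_pos; first by rewrite invr_gt0.
    exact: circle_mean_ge0.
  exact: circle_mean_le.
apply: ge_sup; last by move=> _ [z zr <-]; exact: PM.
by exists (cabs P.[circle_point r 0]), (circle_point r 0) => //; exact: cabs_circle_point.
Qed.

Lemma circle_mean_mono s r P Q : 0 < s -> 0 <= r ->
  (forall z, cabs z = r -> cabs P.[z] <= cabs Q.[z]) ->
  circle_mean s r P <= circle_mean s r Q.
Proof.
move=> s0 r0 PQ; apply: ler_wpM2l.
  by rewrite invr_ge0 mulrn_wge0// pi_ge0.
apply: le_Rintegral => //.
- by apply: continuous_itv_integrable; exact: circle_powR_continuous.
- by apply: continuous_itv_integrable; exact: circle_powR_continuous.
move=> t _; apply: ler_powR_pos => //; first exact: cabs_ge0.
by apply: PQ; exact: cabs_circle_point.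
Qed.

Lemma circle_sup_ge r P z : cabs z = r -> cabs P.[z] <= circle_norm +oo r P.
Proof. by move=> zr; apply: ub_le_sup; [exact: circle_sup_has_ub|exists z]. Qed.

Lemma circle_norm_mono p r P Q : (0 < p)%E -> 0 <= r ->
  (forall z, cabs z = r -> cabs P.[z] <= cabs Q.[z]) ->
  circle_norm p r P <= circle_norm p r Q.
Proof.
move=> p0 r0 PQ; case: p p0 => [s|_|]; last by [].
  rewrite lte_fin => s0; rewrite !circle_normE.
  apply: ler_powR_pos; first by rewrite invr_gt0.
    exact: circle_mean_ge0.
  exact: circle_mean_mono.
apply: circle_norm_le => // z zr; exact: le_trans (PQ _ zr) (circle_sup_ge _ zr).
Qed.

Lemma circle_norm_horner0 p r P : (0 < p)%E -> 0 < r ->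
  cabs P.[0] <= circle_norm p r P.
Proof.
move=> p0 r0; case: p p0 => [s|_|]; last by [].
  rewrite lte_fin => s0; rewrite circle_normE -[leLHS](powR_root s0)// ?cabs_ge0//.
  apply: ler_powR_pos; first by rewrite invr_gt0.
    exact: powR_ge0.
  exact: circle_mean_ge.
(* For the supremum norm, the mean with exponent 1 lies between |P(0)| and the supremum. *)
rewrite -[leLHS]powRr1 ?cabs_ge0//; apply: le_trans (circle_mean_ge P ltr01 r0) _.
apply: (@le_trans _ _ (circle_norm +oo r P `^ 1)); last first.
  by rewrite powRr1// circle_norm_ge0.
apply: circle_mean_le; [exact: ltr01|exact: ltW|].
by move=> z zr; exact: circle_sup_ge.
Qed.

(** Here P = z^k Q, so |P| = r^k |Q| on the circle, and the bound on the constant coefficient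
    applies to r^k Q, whose value at 0 is r^k times the [k]-th coefficient of [P]. *)
Lemma circle_norm_coef_ge p r P k : (0 < p)%E -> 0 < r ->
  (forall j, (j < k)%N -> P`_j = 0) ->
  cabs P`_k * r ^+ k <= circle_norm p r P.
Proof.
move=> p0 r0 Pk.
have PE : P = drop_poly k P * 'X^k.
  rewrite -{1}(poly_take_drop k P) (_ : take_poly k P = 0) ?add0r//.
  by apply/polyP => j; rewrite coef_take_poly coef0; case: ifPn => // /Pk.
pose Q := (r%:C%C ^+ k) *: drop_poly k P.
have -> : cabs P`_k * r ^+ k = cabs Q.[0].
  rewrite hornerZ horner_coef0 coef_drop_poly add0n cabsM cabsX cabs_real ?ltW//.
  by rewrite mulrC.
apply: le_trans (circle_norm_horner0 _ p0 r0) _.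
apply: circle_norm_mono => // [|z zr]; first exact: ltW.
have -> : cabs P.[z] = cabs (drop_poly k P).[z] * r ^+ k.
  by rewrite {1}PE hornerM hornerXn cabsM cabsX zr.
by rewrite hornerZ cabsM cabsX cabs_real ?(ltW r0)// mulrC.
Qed.

(** The sum is at most twice the larger term; this holds for all [s > 0], convex or not. *)
Lemma powRD_le (a b s : R) : 0 <= a -> 0 <= b -> 0 < s ->
  (a + b) `^ s <= 2 `^ s * (a `^ s + b `^ s).
Proof.
move=> a0 b0 s0; wlog ab : a b a0 b0 / a <= b.
  move=> H; have [ab|/ltW ba] := leP a b; first exact: H.
  by rewrite addrC [X in _ * X]addrC H.
apply: (@le_trans _ _ ((2 * b) `^ s)).
  apply: ge0_ler_powR; rewrite ?nnegrE ?addr_ge0 ?mulr_ge0 ?(ltW s0)//.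
  by rewrite mulr_natl mulr2n lerD2r.
by rewrite powRM// ler_wpM2l ?powR_ge0// lerDr powR_ge0.
Qed.

(** The quasi-triangle inequality leaves the mean of [P] plus |P(0)|^s, and the latter is again at
    most the mean of [P]. *)
Lemma circle_mean_subC_le s r P : 0 < s -> 0 < r ->
  circle_mean s r (P - P.[0]%:P) <= 2 `^ s * 2 * circle_mean s r P.
Proof.
move=> s0 r0; pose f t := cabs P.[circle_point r t] `^ s; pose c := cabs P.[0] `^ s.
have mD : measurable (`[0, pi *+ 2]%classic : set (measurableTypeR R)).
  exact: measurable_itv.
have cf : continuous f by exact: circle_powR_continuous.
have cfc : continuous (fun t => f t + c).
  by move=> t; apply: cvgD; [exact: cf|exact: cvg_cst].
have pi2 : 0 < pi *+ 2 :> R by rewrite mulrn_wgt0 ?pi_gt0.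
apply: (@le_trans _ _ ((pi *+ 2)^-1 *
    \int[mu]_(t in `[0, pi *+ 2]) (2 `^ s * (f t + c)))).
  rewrite ler_wpM2l ?invr_ge0 ?(ltW pi2)//; apply: le_Rintegral => //.
  - by apply: continuous_itv_integrable; exact: circle_powR_continuous.
  - apply: (@continuous_itv_integrable _ (fun t => 2 `^ s * (f t + c))) => t.
    by apply: cvgMl_tmp; exact: cfc.
  move=> t _; apply: le_trans (powRD_le (cabs_ge0 _) (cabs_ge0 _) s0).
  apply: ler_powR_pos => //; first exact: cabs_ge0.
  by rewrite hornerD hornerN hornerC -(cabsN P.[0]) cabsD.
rewrite RintegralZl//; last exact: (@continuous_itv_integrable _ (fun t => f t + c)).
rewrite RintegralD//; [|exact: (@continuous_itv_integrable _ f)|]; last first.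
  by apply: (@continuous_itv_integrable _ (cst c)) => x; exact: cvg_cst.
rewrite Rintegral_cst// fine_mu_itv ?(ltW pi2)// subr0 mulrCA -mulrA.
rewrite ler_wpM2l ?powR_ge0// mulrDr [_ * (c * _)]mulrCA mulVf ?gt_eqF// mulr1.
rewrite mulr_natl mulr2n; apply: lerD; first exact: lexx.
exact: circle_mean_ge.
Qed.

(** Removing the constant term costs a factor depending on [p] alone, which gives access to the next
    coefficient. *)
Lemma circle_norm_subC_le p : (0 < p)%E -> exists2 C : R, 0 < C &
  forall r P, 0 < r ->
    circle_norm p r (P - P.[0]%:P) <= C * circle_norm p r P.
Proof.
move=> p0; case: p p0 => [s|_|]; last by [].
  rewrite lte_fin => s0.
  exists ((2 `^ s * 2) `^ s^-1); first by rewrite powR_gt0// mulr_gt0// powR_gt0.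
  move=> r P r0; rewrite !circle_normE.
  have c0 : 0 <= 2 `^ s * 2 :> R by rewrite mulr_ge0// powR_ge0.
  rewrite -(powRM _ c0 (circle_mean_ge0 _ _ _)).
  apply: ler_powR_pos; first by rewrite invr_gt0.
    exact: circle_mean_ge0.
  exact: circle_mean_subC_le.
exists 2; first exact: ltr0n.
move=> r P r0; apply: circle_norm_le; [exact: ltry|exact: ltW|] => z zr.
rewrite hornerD hornerN hornerC; apply: le_trans (cabsD _ _) _.
rewrite cabsN mulr_natl mulr2n; apply: lerD; first exact: circle_sup_ge.
exact: circle_norm_horner0.
Qed.

(* Apply the bound on the constant coefficient to (P - P(0)) / z; for p < 1 the
   quasi-triangle inequality suffices. *)
Lemma circle_norm_coef1_ge p : (0 < p)%E -> exists2 C : R, 0 < C &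
  forall r P, 0 < r -> cabs P`_1 * r <= C * circle_norm p r P.
Proof.
move=> p0; have [C C0 CP] := circle_norm_subC_le p0; exists C => // r P r0.
apply: le_trans (CP r P r0).
have := @circle_norm_coef_ge p r (P - P.[0]%:P) 1 p0 r0.
rewrite expr1 coefB coefC subr0; apply => j; rewrite ltnS leqn0 => /eqP ->.
by rewrite coefB coefC eqxx horner_coef0 subrr.
Qed.

End circle_norms.

(** * Convergence of the norms of partial sums and of their ratio *)

Section partial_sums.
Variable R : realType.
Implicit Types (P Q : {poly R[i]}) (r s : R) (p : \bar R) (a : nat -> R[i]).

(** The telescoping series of the increments converges absolutely. *)
Lemma cvg_summable_steps (x u : nat -> R) (B : R) :
  (forall n, `|x n.+1 - x n| <= u n) ->
  (forall n, \sum_(0 <= k < n) u k <= B) -> cvgn x.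
Proof.
move=> xu uB; have u0 n : 0 <= u n := le_trans (normr_ge0 _) (xu n).
have cu : cvgn (series u).
  apply: nondecreasing_is_cvgn; first exact: nondecreasing_series.
  by exists B => _ [n _ <-]; exact: uB.
have cx : cvgn (series (telescope x)).
  by apply: normed_cvg; apply: (series_le_cvg _ u0 xu cu) => n; exact: normr_ge0.
have -> : x = (fun n => x 0%N + series (telescope x) n).
  by apply/funext => n; exact: eq_sum_telescope.
by apply: is_cvgD => //; exact: is_cvg_cst.
Qed.

Lemma cabs_poly_le a r n (z : R[i]) : cabs z = r ->
  cabs (\poly_(k < n) a k).[z] <= \sum_(0 <= k < n) cabs (a k) * r ^+ k.
Proof.
move=> zr; rewrite horner_poly big_mkord; apply: le_trans (cabs_sum _ _) _.
by apply: ler_sum => i _; rewrite cabsM cabsX zr.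
Qed.

Lemma poly_recr a n : \poly_(k < n.+1) a k = \poly_(k < n) a k + a n *: 'X^n.
Proof.
apply/polyP => i; rewrite coefD coefZ coefXn !coef_poly ltnS leq_eqVlt.
have [->|ni] := eqVneq i n; first by rewrite ltnn add0r mulr1.
by rewrite mulr0 addr0.
Qed.

Lemma deriv_polyE a n :
  (\poly_(k < n.+1) a k)^`() = \poly_(k < n) (a k.+1 *+ k.+1).
Proof.
apply/polyP => i; rewrite coef_deriv !coef_poly ltnS.
by case: ifP => // _; rewrite mul0rn.
Qed.

Lemma circle_norm0 p r : (0 < p)%E -> 0 < r -> circle_norm p r (0 : {poly R[i]}) = 0.
Proof.
move=> p0 r0; apply/eqP; rewrite eq_le circle_norm_ge0 andbT.
apply: circle_norm_le => // [|z _]; first exact: ltW.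
by rewrite horner0 cabs0.
Qed.

(** The convention at [P = 0] agrees with the plain quotient, whose numerator vanishes there; no
    case distinction is needed afterwards. *)
Lemma norm_ratioE p r P : (0 < p)%E -> 0 < r ->
  norm_ratio p r P = circle_norm p r P^`() / circle_norm p r P.
Proof.
move=> p0 r0; rewrite /norm_ratio; case: eqP => [->|//].
by rewrite deriv0 circle_norm0// mul0r.
Qed.

Lemma circle_norm_poly_le p r a n : (0 < p)%E -> 0 < r ->
  circle_norm p r (\poly_(k < n) a k) <= \sum_(0 <= k < n) cabs (a k) * r ^+ k.
Proof.
move=> p0 r0; apply: circle_norm_le => // [|z zr]; first exact: ltW.
exact: cabs_poly_le.
Qed.

Lemma circle_sup_dist_le r P Q (M : R) : 0 < r ->
  (forall z, cabs z = r -> cabs (P.[z] - Q.[z]) <= M) ->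
  `|circle_norm +oo r P - circle_norm +oo r Q| <= M.
Proof.
move=> r0 PQ.
have H (P1 Q1 : {poly R[i]}) :
    (forall z, cabs z = r -> cabs (P1.[z] - Q1.[z]) <= M) ->
    circle_norm +oo r P1 <= circle_norm +oo r Q1 + M.
  move=> PQ1; apply: circle_norm_le; [exact: ltry|exact: ltW|] => z zr.
  rewrite addrC -{1}(subrK Q1.[z] P1.[z]).
  apply: le_trans (cabsD _ _) _; apply: lerD; first exact: PQ1.
  exact: circle_sup_ge.
rewrite ler_norml lerBlDr lerNl opprB lerBlDr ![M + _]addrC.
apply/andP; split; apply: H => // z zr.
by rewrite cabsC; exact: PQ.
Qed.

(** For finite [p] the moduli converge pointwise under the common bound [B], so the means converge;
    this avoids a triangle inequality, false for p < 1. For the supremum norm the steps themselves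
    are summable. *)
Lemma circle_norm_partial_cvg p r a (B : R) : (0 < p)%E -> 0 < r ->
  (forall n, \sum_(0 <= k < n) cabs (a k) * r ^+ k <= B) ->
  cvgn (fun n => circle_norm p r (\poly_(k < n) a k)).
Proof.
move=> p0 r0 aB.
have step n z : cabs z = r -> cabs ((\poly_(k < n.+1) a k).[z] -
    (\poly_(k < n) a k).[z]) <= cabs (a n) * r ^+ n.
  move=> zr; rewrite poly_recr hornerD addrAC subrr add0r.
  by rewrite hornerZ hornerXn cabsM cabsX zr.
case: p p0 => [s|_|]; last by [].
  rewrite lte_fin => s0.
  have pt t : cvgn (fun n => cabs (\poly_(k < n) a k).[circle_point r t]).
    apply: cvg_summable_steps aB => n; apply: le_trans (cabs_dist _ _) _.
    by apply: step; rewrite cabs_circle_point// ltW.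
  pose g t := limn (fun n => cabs (\poly_(k < n) a k).[circle_point r t]).
  have := @circle_mean_cvg R s (fun n => \poly_(k < n) a k) (fun=> r) g B s0.
  set m := (X in _ --> X) => h.
  have m0 : 0 <= m.
    apply: mulr_ge0; first by rewrite invr_ge0 mulrn_wge0// pi_ge0.
    by apply: Rintegral_ge0 => t _; exact: powR_ge0.
  under eq_fun do rewrite circle_normE.
  apply/cvg_ex; exists (m `^ s^-1).
  apply: powR_cvg; [by rewrite invr_gt0| |exact: m0|].
    by move=> n; exact: circle_mean_ge0.
  apply: h => [n t|t]; last exact: pt.
  by apply: le_trans (aB n); apply: cabs_poly_le; rewrite cabs_circle_point// ltW.
apply: (@cvg_summable_steps _ (fun k => cabs (a k) * r ^+ k) B) aB => n.
by apply: circle_sup_dist_le => // z; exact: step.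
Qed.

(** Once the first nonzero coefficient a_k has entered the partial sum, the norm stays at least
    |a_k| r^k. *)
Lemma circle_norm_partial_lim_gt0 p r a (B : R) : (0 < p)%E -> 0 < r ->
  (forall n, \sum_(0 <= k < n) cabs (a k) * r ^+ k <= B) ->
  (exists k, a k != 0) ->
  0 < limn (fun n => circle_norm p r (\poly_(k < n) a k)).
Proof.
move=> p0 r0 aB exa; pose k := ex_minn exa.
have [ak kmin] : a k != 0 /\ forall j, (j < k)%N -> a j = 0.
  rewrite /k; case: ex_minnP => m am mmin; split=> // j jm.
  by apply/eqP; apply: contraTT jm => aj; rewrite -leqNgt mmin.
apply: (@lt_le_trans _ _ (cabs (a k) * r ^+ k)).
  by rewrite mulr_gt0 ?exprn_gt0// cabs_gt0.
apply: limr_ge; first exact: circle_norm_partial_cvg aB.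
near=> n; have kn : (k < n)%N by near: n; exact: nbhs_infty_gt.
have := @circle_norm_coef_ge R p r (\poly_(k < n) a k) k p0 r0.
rewrite coef_poly kn; apply => j jk.
by rewrite coef_poly (ltn_trans jk kn) kmin.
Unshelve. all: by end_near. Qed.

Lemma norm_ratio_cvg p r a (B : R) : (0 < p)%E -> 0 < r ->
  (forall n, \sum_(0 <= k < n) cabs (a k.+1) *+ k.+1 * r ^+ k <= B) ->
  (exists k, a k.+1 != 0) ->
  exists2 l : R, 0 < l & norm_ratio p r (\poly_(k < n.+1) a k) @[n --> \oo] --> l.
Proof.
move=> p0 r0 aB [k ak].
have dB n : \sum_(0 <= k < n) cabs (a k.+1 *+ k.+1) * r ^+ k <= B.
  apply: le_trans (aB n); rewrite le_eqVlt; apply/orP; left; apply/eqP.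
  by apply: eq_bigr => j _; rewrite -mulr_natr cabsM cabs_nat mulr_natr.
(* Apart from its constant term, the series is dominated by [r] times the series of the
   derivative. *)
have sB n : \sum_(0 <= k < n) cabs (a k) * r ^+ k <= cabs (a 0%N) + r * B.
  have B0 : 0 <= B by have := aB 0%N; rewrite big_nil.
  case: n => [|n]; first by rewrite big_nil addr_ge0 ?cabs_ge0// mulr_ge0// ltW.
  rewrite big_nat_recl//= expr0 mulr1 lerD2l.
  apply: le_trans (ler_wpM2l (ltW r0) (aB n)); rewrite mulr_sumr.
  apply: ler_sum => j _; rewrite exprS mulrCA ler_wpM2l ?(ltW r0)//.
  rewrite ler_wpM2r ?exprn_ge0 ?(ltW r0)// -mulr_natr ler_peMr ?cabs_ge0//.
  by rewrite ler1n.
have d0 : exists k, a k.+1 *+ k.+1 != 0.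
  by exists k; rewrite mulrn_eq0/= ak.
have s0 : exists k, a k != 0 by exists k.+1.
have cd := circle_norm_partial_cvg p0 r0 dB.
have cs := circle_norm_partial_cvg p0 r0 sB.
have ld := circle_norm_partial_lim_gt0 p0 r0 dB d0.
have ls := circle_norm_partial_lim_gt0 p0 r0 sB s0.
set Ld := limn _ in ld; set Ls := limn _ in ls.
exists (Ld / Ls); first by rewrite divr_gt0.
have -> : (fun n => norm_ratio p r (\poly_(k < n.+1) a k)) =
    (fun n => circle_norm p r (\poly_(k < n) (a k.+1 *+ k.+1)) /
              circle_norm p r (\poly_(k < n.+1) a k)).
  by apply/funext => n; rewrite norm_ratioE// deriv_polyE.
apply: cvgM; first exact: cd.
apply: cvgV; first by rewrite gt_eqF.
by move: cs; rewrite -cvg_shiftS.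
Qed.

End partial_sums.

(** * Measurability of the norms and of the ratio as functions of random coefficients *)

Section measurability.
Context d (T : measurableType d) (R : realType).
Variable a : nat -> T -> R[i].
Hypothesis mRe : forall k, measurable_fun setT (fun w => complex.Re (a k w)).
Hypothesis mIm : forall k, measurable_fun setT (fun w => complex.Im (a k w)).

Lemma measurable_powR_comp (s : R) (f : T -> R) : measurable_fun setT f ->
  measurable_fun setT (fun w => f w `^ s).
Proof. by move=> mf; exact: (measurableT_comp (measurable_powR s) mf). Qed.

Lemma measurable_cabs_comp (f : T -> R[i]) :
  measurable_fun setT (fun w => complex.Re (f w)) ->
  measurable_fun setT (fun w => complex.Im (f w)) ->
  measurable_fun setT (fun w => cabs (f w)).
Proof.
move=> mr mi.
have -> : (fun w => cabs (f w)) =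
    (@Num.sqrt R) \o (fun w => complex.Re (f w) ^+ 2 + complex.Im (f w) ^+ 2).
  by apply/funext => w /=; case: (f w).
apply: measurableT_comp.
  by apply: continuous_measurable_fun; exact: sqrt_continuous.
by apply: measurable_funD; exact: measurable_funX.
Qed.

Lemma measurable_cabs_poly n (z : R[i]) :
  measurable_fun setT (fun w => cabs (\poly_(k < n) a k w).[z]).
Proof.
suff [mr mi] : measurable_fun setT (fun w => complex.Re (\poly_(k < n) a k w).[z])
    /\ measurable_fun setT (fun w => complex.Im (\poly_(k < n) a k w).[z]).
  exact: measurable_cabs_comp.
elim: n => [|n [IHr IHi]].
  have e w : (\poly_(k < 0) a k w).[z] = 0 by rewrite horner_poly big_ord0.
  by split; under eq_fun do rewrite e; exact: measurable_cst.
have e w : (\poly_(k < n.+1) a k w).[z] = a n w * z ^+ n + (\poly_(k < n) a k w).[z].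
  by rewrite (poly_recr (a ^~ w)) hornerD hornerZ hornerXn addrC.
split; under eq_fun do rewrite e ?ReMD ?ImMD; apply: measurable_funD => //.
  by apply: measurable_funB; apply: measurable_funM => //; exact: measurable_cst.
by apply: measurable_funD; apply: measurable_funM => //; exact: measurable_cst.
Qed.

(** The rationals listed as a sequence, with 0 at codes of no rational; used to write the supremum
    norm as a countable supremum. *)
Definition rational_seq (m : nat) : R := ratr (odflt 0 (unpickle m)).

(** Rational angles suffice: a value exceeding their supremum would, by continuity, be exceeding on
    a nonempty open set of angles, which contains a rational. *)
Lemma circle_sup_rational r (P : {poly R[i]}) : 0 < r ->
  circle_norm +oo r P =
  sups (fun m => cabs P.[circle_point r (rational_seq m)]) 0%N.
Proof.
move=> r0; set g := fun t => cabs P.[circle_point r t].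
have cg : continuous g.
  move=> t; apply: horner_cabs_cvg => /=; apply: cvgMl_tmp.
    exact: continuous_cos.
  exact: continuous_sin.
have gub t : g t <= circle_norm +oo r P.
  by apply: circle_sup_ge; rewrite cabs_circle_point// ltW.
have hu : has_ubound (sdrop (fun m => g (rational_seq m)) 0%N).
  by exists (circle_norm +oo r P) => _ [m _ <-]; exact: gub.
apply/eqP; rewrite eq_le; apply/andP; split.
  apply: circle_norm_le; [exact: ltry|exact: ltW|] => z zr.
  have [t ->] := circle_point_surj r0 zr.
  rewrite leNgt; apply/negP => gt.
  have := @dense_rat R (g @^-1` [set x | sups (fun m => g (rational_seq m)) 0%N < x]).
  case.
  - by exists t.
  - by apply: open_comp; [move=> x _; exact: cg|exact: open_gt].
  move=> x [/= xS [q _ qx]]; move: xS.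
  have <- : rational_seq (pickle q) = x by rewrite /rational_seq pickleK.
  by apply/negP; rewrite -leNgt; apply: ub_le_sup => //; exists (pickle q).
apply: ge_sup; last by move=> _ [m _ <-]; exact: gub.
by exists (g (rational_seq 0%N)), 0%N.
Qed.

(** For finite [p] the mean is a pointwise limit of grid averages; the supremum norm is a countable
    supremum. *)
Lemma measurable_circle_norm p r n : (0 < p)%E -> 0 < r ->
  measurable_fun setT (fun w => circle_norm p r (\poly_(k < n) a k w)).
Proof.
move=> p0 r0; case: p p0 => [s|_|]; last by [].
  rewrite lte_fin => s0; under eq_fun do rewrite circle_normE.
  apply: measurable_powR_comp.
  apply: (@measurable_fun_cvg _ _ _ _ (fun m w => m.+1%:R^-1 * \sum_(0 <= j < m.+1)
    cabs (\poly_(k < n) a k w).[circle_point r (j%:R * (pi *+ 2 / m.+1%:R))] `^ s)).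
    move=> m; apply: measurable_funM; first exact: measurable_cst.
    apply: measurable_sum => j; apply: measurable_powR_comp.
    exact: measurable_cabs_poly.
  by move=> w _; exact: circle_mean_grid_cvg.
under eq_fun do rewrite circle_sup_rational//.
apply: measurable_fun_sups => [w _|m]; last exact: measurable_cabs_poly.
exists (circle_norm +oo r (\poly_(k < n) a k w)) => _ [m _ <-].
by apply: circle_sup_ge; rewrite cabs_circle_point// ltW.
Qed.

End measurability.

Section measurability_ratio.
Context d (T : measurableType d) (R : realType).
Variable a : nat -> T -> R[i].
Hypothesis mRe : forall k, measurable_fun setT (fun w => complex.Re (a k w)).
Hypothesis mIm : forall k, measurable_fun setT (fun w => complex.Im (a k w)).

Lemma measurable_norm_ratio p r n : (0 < p)%E -> 0 < r ->
  measurable_fun setT (fun w => norm_ratio p r (\poly_(k < n.+1) a k w)).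
Proof.
move=> p0 r0.
(* The inverse is written as a power with exponent -1, so that [measurable_powR] applies, also where
   the norm vanishes. *)
have e w : norm_ratio p r (\poly_(k < n.+1) a k w) =
    circle_norm p r (\poly_(k < n) (a k.+1 w *+ k.+1)) *
    circle_norm p r (\poly_(k < n.+1) a k w) `^ (-1).
  rewrite norm_ratioE// (deriv_polyE (a ^~ w)) powR_inv1//.
  exact: circle_norm_ge0.
under eq_fun do rewrite e.
apply: measurable_funM; last first.
  apply: measurable_powR_comp.
  exact: measurable_circle_norm.
apply: (@measurable_circle_norm _ _ _ (fun k w => a k.+1 w *+ k.+1)) => // k.
  have -> : (fun w => complex.Re (a k.+1 w *+ k.+1)) =
      (fun w => complex.Re (a k.+1 w) * k.+1%:R).
    apply/funext => w; rewrite mulr_natr; move: (a k.+1 w) => z.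
    by elim: (k.+1) => [|j IH]; rewrite ?mulr0n// !mulrS raddfD/= IH.
  by apply: measurable_funM => //; exact: measurable_cst.
have -> : (fun w => complex.Im (a k.+1 w *+ k.+1)) =
    (fun w => complex.Im (a k.+1 w) * k.+1%:R).
  apply/funext => w; rewrite mulr_natr; move: (a k.+1 w) => z.
  by elim: (k.+1) => [|j IH]; rewrite ?mulr0n// !mulrS raddfD/= IH.
by apply: measurable_funM => //; exact: measurable_cst.
Qed.

End measurability_ratio.

(** * Expectations estimated by tails at integer levels *)

Section counting_levels.
Context d (T : measurableType d) (R : realType) (Pr : probability T R).
Implicit Types (Y Z : T -> R) (y : R).

(** With [le_sum_lt], a discrete layer-cake formula: the number of natural numbers below [y] lies
    between [y] and [y + 1]. *)
Lemma sum_lt_le y n : 0 <= y -> \sum_(0 <= j < n) ((j%:R < y)%R)%:R <= y + 1 :> R.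
Proof.
move=> y0; have H m : \sum_(0 <= j < m) ((j%:R < y)%R)%:R <= m%:R :> R.
  elim: m => [|m IH]; first by rewrite big_nil.
  by rewrite big_nat_recr//= -natr1 lerD// lern1; case: (_ < _).
elim: n => [|n IH]; first by rewrite big_nil addr_ge0.
rewrite big_nat_recr//=; case: ltP => [ny|_]; last by rewrite addr0.
by rewrite lerD2r (le_trans (H n))// ltW.
Qed.

Lemma le_sum_lt y : \forall n \near \oo,
  y <= \sum_(0 <= j < n) ((j%:R < y)%R)%:R.
Proof.
have H n : n%:R <= \sum_(0 <= j < n) ((j%:R < y)%R)%:R :> R \/
    y <= \sum_(0 <= j < n) ((j%:R < y)%R)%:R.
  elim: n => [|n [IH|IH]]; first by left; rewrite big_nil.
    rewrite big_nat_recr//=; case: ltP => [ny|yn].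
      by left; rewrite -natr1 lerD2r.
    by right; rewrite addr0 (le_trans yn).
  by right; rewrite big_nat_recr//= (le_trans IH)// lerDl.
near=> n; have [Hn|//] := H n; apply: le_trans Hn.
by near: n; exact: nbhs_infty_ger.
Unshelve. all: by end_near. Qed.

Local Open Scope ereal_scope.

Lemma measurable_level Y j : measurable_fun setT Y ->
  measurable [set w | (j%:R < Y w)%R].
Proof.
move=> mY; have -> : [set w | (j%:R < Y w)%R] = setT `&` Y @^-1` `]j%:R, +oo[%classic.
  by rewrite setTI; apply/seteqP; split=> w /=; rewrite in_itv/= andbT.
exact: mY.
Qed.

(** The counting bound [sum_lt_le] is integrated term by term. *)
Lemma sum_level_prob_le Y : measurable_fun setT Y -> (forall w, 0 <= Y w)%R ->
  \sum_(j <oo) Pr [set w | (j%:R < Y w)%R] <= 'E_Pr[Y] + 1.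
Proof.
move=> mY Y0; have -> : 'E_Pr[Y] = \int[Pr]_w (Y w)%:E by rewrite unlock.
have -> : \int[Pr]_w (Y w)%:E + 1 = \int[Pr]_w (Y w + 1)%:E.
  under [RHS]eq_integral do rewrite EFinD.
  rewrite ge0_integralD//; last exact/measurable_EFinP.
    by rewrite integral_cst// [X in _ = _ + 1 * X](probability_setT Pr) mule1.
  by move=> w _; rewrite lee_fin.
apply: lime_le; first exact: is_cvg_nneseries.
apply: nearW => n.
have -> : \sum_(0 <= j < n) Pr [set w | (j%:R < Y w)%R] =
    \int[Pr]_w (\sum_(0 <= j < n) (\1_[set w | (j%:R < Y w)%R] w)%:E).
  rewrite ge0_integral_sum//.
  - apply: eq_bigr => j _; rewrite integral_indic ?setIT//.
    exact: measurable_level.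
  - move=> j; apply/measurable_EFinP/measurable_indic; exact: measurable_level.
apply: ge0_le_integral => //.
- by move=> w _; rewrite sumEFin lee_fin sumr_ge0.
- apply: emeasurable_sum => j.
  apply/measurable_EFinP/measurable_indic; exact: measurable_level.
- by apply/measurable_EFinP; apply: measurable_funD => //; exact: measurable_cst.
move=> w _; rewrite sumEFin lee_fin.
under eq_bigr => j _ do rewrite indicE mem_setE.
exact: sum_lt_le.
Qed.

(* Both factors are bounded by the number of integer levels below them, so only
   the joint tails at integers matter; this replaces the factorisation of the
   expectation of a product of independent variables. *)
Lemma integral_mul_le Y Z (a b : nat -> R) :
  measurable_fun setT Y -> measurable_fun setT Z ->
  (forall w, 0 <= Y w)%R -> (forall w, 0 <= Z w)%R ->
  (forall j, 0 <= a j)%R -> (forall m, 0 <= b m)%R ->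
  (forall j m, Pr ([set w | (j%:R < Y w)%R] `&` [set w | (m%:R < Z w)%R]) <=
    (a j * b m)%:E) ->
  \sum_(m <oo) (b m)%:E \is a fin_num ->
  \int[Pr]_w (Y w * Z w)%:E <=
    (\sum_(j <oo) (a j)%:E) * (\sum_(m <oo) (b m)%:E).
Proof.
move=> mY mZ Y0 Z0 a0 b0 Pab bfin.
pose E j m := [set w | (j%:R < Y w)%R] `&` [set w | (m%:R < Z w)%R].
have mE j m : measurable (E j m).
  by apply: measurableI; exact: measurable_level.
have mI j m : measurable_fun setT (fun w => (\1_(E j m) w)%:E : \bar R).
  exact/measurable_EFinP/measurable_indic.
apply: (@le_trans _ _ (\int[Pr]_w (\sum_(j <oo) \sum_(m <oo) (\1_(E j m) w)%:E))).
  apply: ge0_le_integral => //.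
  - by move=> w _; rewrite lee_fin mulr_ge0.
  - by apply/measurable_EFinP; exact: measurable_funM.
  - apply: ge0_emeasurable_sum => [j w _ _|j _]; first exact: nneseries_ge0.
    by apply: ge0_emeasurable_sum.
  move=> w _.
  (* A finite cutoff [n], depending on [w], suffices for both factors, so their product is bounded
     by a finite double count of pairs of levels. *)
  have [n [Yn Zn]] := filter_ex (filterI (le_sum_lt (Y w)) (le_sum_lt (Z w))).
  apply: (@le_trans _ _ (\sum_(0 <= j < n) \sum_(0 <= m < n) (\1_(E j m) w)%:E)).
    under eq_bigr do rewrite sumEFin.
    rewrite sumEFin lee_fin (le_trans (ler_pM _ _ Yn Zn))// big_distrlr/=.
    rewrite le_eqVlt; apply/orP; left; apply/eqP.
    apply: eq_bigr => j _; apply: eq_bigr => m _.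
    by rewrite indicE in_setI !mem_setE -mulnb natrM.
  apply: le_trans (nneseries_lim_ge _ _) => //; last first.
    by move=> j _ _; exact: nneseries_ge0.
  by apply: lee_sum => j _; exact: nneseries_lim_ge.
rewrite integral_nneseries//; last 2 first.
- by move=> j; apply: ge0_emeasurable_sum.
- by move=> j w _; exact: nneseries_ge0.
have aE i : true -> 0 <= (a i)%:E by move=> _; rewrite lee_fin.
have bE i : true -> 0 <= (b i)%:E by move=> _; rewrite lee_fin.
(* Being finite, the sum of the [b m] can be moved inside the series over [j] as a real scalar. *)
rewrite -[X in _ <= _ * X]fineK// muleC -(nneseriesZl _ _ aE)//.
apply: lee_nneseries => [j _ _|j _].
  by apply: integral_ge0 => w _; exact: nneseries_ge0.
rewrite integral_nneseries// muleC fineK// -(nneseriesZl _ _ bE)//.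
apply: lee_nneseries => [m _ _|m _]; first by apply: integral_ge0.
by rewrite integral_indic// setIT -EFinM; exact: Pab.
Qed.

End counting_levels.

(** * Borel measurability of the coordinates and the modulus on the complex plane *)

Section complex_measurability.
Variable R : realType.

Lemma measurable_Re : measurable_fun setT (fun z : R[i] => complex.Re z).
Proof.
move=> _ B mB; rewrite setTI; exists (B `*` setT); first exact: measurableX.
by apply/seteqP; split=> [z [_ []]|z Bz] //=; split.
Qed.

Lemma measurable_Im : measurable_fun setT (fun z : R[i] => complex.Im z).
Proof.
move=> _ B mB; rewrite setTI; exists (setT `*` B); first exact: measurableX.
by apply/seteqP; split=> [z [_ []]|z Bz] //=; split.
Qed.

Lemma measurable_cabs : measurable_fun setT (fun z : R[i] => cabs z).
Proof.
by apply: measurable_cabs_comp; [exact: measurable_Re|exact: measurable_Im].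
Qed.

Lemma measurable_complex0 : measurable [set 0 : R[i]].
Proof.
have -> : [set 0 : R[i]] = setT `&` (fun z : R[i] => cabs z) @^-1` [set 0].
  apply/seteqP; split=> z /=; first by move=> ->; rewrite cabs0.
  by move=> [_ /eqP]; rewrite cabs_eq0 => /eqP.
exact: measurable_cabs.
Qed.

End complex_measurability.

(** * Power series with geometrically dominated terms, and the truncated logarithm *)

Section power_series_bounds.
Variable R : realType.
Implicit Types (r rho : R).

(** Multiplied by (1 - rho)^2 the sum has the closed form 1 - (n+1) rho^n + n rho^(n+1), which is at
    most 1. *)
Lemma sum_succ_geom_le rho n : 0 <= rho < 1 ->
  \sum_(0 <= k < n) k.+1%:R * rho ^+ k <= (1 - rho) ^- 2.
Proof.
move=> /andP[rho0 rho1].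
have E : (1 - rho) ^+ 2 * \sum_(0 <= k < n) k.+1%:R * rho ^+ k =
    1 - n.+1%:R * rho ^+ n + n%:R * rho ^+ n.+1.
  elim: n => [|n IH]; first by rewrite big_nil expr0; ring.
  rewrite big_nat_recr//= mulrDr IH !exprS -(natr1 n.+1) -(natr1 n).
  by ring.
have d0 : 0 < (1 - rho) ^+ 2 by rewrite exprn_gt0// subr_gt0.
rewrite -[leRHS]mulr1 mulrC ler_pdivlMr// mulrC E -addrA gerDl addrC subr_le0.
apply: ler_pM => //; first by rewrite exprn_ge0.
  by rewrite ler_nat.
by rewrite exprS ler_piMl ?exprn_ge0// ltW.
Qed.

(** From index [N] on, the terms are at most (k+1) rho^k / r, whose sum is bounded; the earlier
    terms contribute a constant. *)
Lemma deriv_series_bounded (c : nat -> R) r rho N : 0 < r -> 0 <= rho < 1 ->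
  (forall k, 0 <= c k) -> (forall k, (N <= k)%N -> c k * r ^+ k <= rho ^+ k) ->
  exists B, forall n, \sum_(0 <= k < n) c k.+1 *+ k.+1 * r ^+ k <= B.
Proof.
move=> r0 rho01 c0 cN; have /andP[rho0 rho1] := rho01.
pose t k := c k.+1 *+ k.+1 * r ^+ k.
have t0 k : 0 <= t k by rewrite mulr_ge0 ?mulrn_wge0// exprn_ge0// ltW.
have tN k : (N <= k)%N -> t k <= r^-1 * (k.+1%:R * rho ^+ k).
  move=> Nk; rewrite ler_pdivlMl//.
  have -> : r * t k = k.+1%:R * (c k.+1 * r ^+ k.+1).
    by rewrite /t -mulr_natr exprS; ring.
  rewrite ler_wpM2l//.
  apply: le_trans (cN k.+1 (leqW Nk)) _.
  by rewrite exprS ler_piMl ?exprn_ge0// ltW.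
exists (\sum_(0 <= k < N) t k + r^-1 * (1 - rho) ^- 2) => n.
have s0 m : 0 <= r^-1 * (m.+1%:R * rho ^+ m).
  by rewrite mulr_ge0 ?invr_ge0 ?(ltW r0)// mulr_ge0// exprn_ge0.
have [nN|/ltnW Nn] := leqP n N.
  rewrite [X in _ <= X + _](big_cat_nat _ _ (n := n))//= -addrA lerDl addr_ge0 ?sumr_ge0//.
  by rewrite mulr_ge0 ?invr_ge0 ?(ltW r0)// exprn_ge0// subr_ge0 ltW.
rewrite (big_cat_nat _ _ (n := N))//= lerD2l.
apply: (@le_trans _ _ (\sum_(N <= k < n) r^-1 * (k.+1%:R * rho ^+ k))).
  rewrite big_nat_cond [leRHS]big_nat_cond; apply: ler_sum => k.
  by rewrite andbT => /andP[Nk _]; exact: tN.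
apply: (@le_trans _ _ (\sum_(0 <= k < n) r^-1 * (k.+1%:R * rho ^+ k))).
  by rewrite [leRHS](big_cat_nat _ _ (n := N))//= lerDr sumr_ge0.
by rewrite -mulr_sumr ler_wpM2l ?invr_ge0 ?(ltW r0)// sum_succ_geom_le.
Qed.

Lemma measurable_log_plus : measurable_fun setT (@log_plus R).
Proof.
by apply: measurable_maxr; [exact: measurable_ln|exact: measurable_cst].
Qed.

Lemma le_expR_log_plus (x y : R) : 0 <= x -> log_plus x <= y -> x <= expR y.
Proof.
rewrite le_eqVlt => /predU1P[<- _|x0]; first exact: expR_ge0.
by rewrite /log_plus ge_max => /andP[xy _]; rewrite -[leLHS]lnK ?posrE// ler_expR.
Qed.

End power_series_bounds.

(** * Almost sure growth and nonvanishing of i.i.d. coefficients *)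

Section iid_coefficients.
Context d (T : measurableType d) (R : realType) (Pr : probability T R).
Variable A : nat -> {RV Pr >-> R[i]}.
Hypothesis iidA : iid A.

Local Open Scope ereal_scope.

Lemma iid_prob k (B : set R[i]) : measurable B ->
  Pr (A k @^-1` B) = Pr (A 0%N @^-1` B).
Proof. by move=> mB; case: iidA => _ /(_ k 0%N B mB). Qed.

Lemma measurable_preimage_RV k (B : set R[i]) : measurable B ->
  measurable (A k @^-1` B).
Proof. by move=> mB; rewrite -[X in measurable X]setTI; exact: measurable_funPT. Qed.

Lemma measurable_cabs_RV k : measurable_fun setT (fun w => cabs (A k w)).
Proof. exact: (measurableT_comp (@measurable_cabs R) (measurable_funPT (A k))). Qed.

Lemma measurable_log_plus_RV k :
  measurable_fun setT (fun w => log_plus (cabs (A k w))).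
Proof.
have H := measurableT_comp (@measurable_log_plus R) (measurable_cabs_RV k).
exact: H.
Qed.

(** Borel-Cantelli: by identical distribution the probabilities of log^+|A_k| > e k are tails at
    integer levels of log^+|A_0| / e, whose sum is at most its expectation plus 1. *)
Lemma ae_coef_growth (e : R) : (0 < e)%R ->
  'E_Pr[fun w => log_plus (cabs (A 0%N w))] < +oo ->
  {ae Pr, forall w, \forall k \near \oo, (log_plus (cabs (A k w)) <= e * k%:R)%R}.
Proof.
move=> e0 Efin; pose Y k w := (e^-1 * log_plus (cabs (A k w)))%R.
pose B k := [set z : R[i] | (k%:R < e^-1 * log_plus (cabs z))%R].
have mlog : measurable_fun setT (fun z : R[i] => e^-1 * log_plus (cabs z))%R.
  apply: measurable_funM; first exact: measurable_cst.
  have H := (measurableT_comp (@measurable_log_plus R) (@measurable_cabs R)). exact: H.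
have mB k : measurable (B k) by exact: measurable_level.
pose F k := A k @^-1` B k.
have mF k : measurable (F k) by exact: measurable_preimage_RV.
have sF : \sum_(k <oo) Pr (F k) < +oo.
  rewrite (_ : (fun n => \sum_(0 <= k < n) Pr (F k)) =
    (fun n => \sum_(0 <= k < n) Pr [set w | (k%:R < Y 0%N w)%R])); last first.
    by apply/funext => n; apply: eq_bigr => k _; rewrite /F iid_prob.
  have mY : measurable_fun setT (Y 0%N).
    exact: (measurableT_comp mlog (measurable_funPT (A 0%N))).
  have log0 (x : R) : (0 <= log_plus x)%R by rewrite /log_plus le_max lexx orbT.
  have Y0 w : (0 <= Y 0%N w)%R by rewrite mulr_ge0 ?log0// invr_ge0 ltW.
  apply: le_lt_trans (sum_level_prob_le Pr mY Y0) _.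
  rewrite lte_add_pinfty ?ltry//.
  have -> : 'E_Pr[Y 0%N] = \int[Pr]_w ((e^-1)%:E * (log_plus (cabs (A 0%N w)))%:E).
    by rewrite unlock; apply: eq_integral => w _; rewrite EFinM.
  rewrite ge0_integralZl_EFin//.
  - by rewrite lte_mul_pinfty ?lee_fin ?invr_ge0 ?(ltW e0)//; move: Efin; rewrite unlock.
  - by move=> w _; rewrite lee_fin.
  - apply/measurable_EFinP; exact: measurable_log_plus_RV.
  - by rewrite invr_ge0 ltW.
(* Outside this null set only finitely many of the events [F k] occur. *)
exists (lim_sup_set F); split.
- by apply: bigcap_measurable => // k _; apply: bigcup_measurable.
- exact: lim_sup_set_cvg0.
move=> w /= nw n _; apply: contrapT => Fw; apply: nw; near=> k.
have nk : (n <= k)%N by near: k; exact: nbhs_infty_ge.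
rewrite leNgt; apply/negP => ek; apply: Fw; exists k => //=.
by rewrite /F /B/= ltr_pdivlMl.
Unshelve. all: by end_near. Qed.

(** By independence A_1, ..., A_n all vanish with probability q^n, which tends to 0. Index 0 is left
    out because the derivative forgets the constant term. *)
Lemma ae_coef_neq0 : Pr [set w | A 0%N w = 0%R] < 1 ->
  {ae Pr, forall w, exists k, (A k.+1 w != 0)%R}.
Proof.
move=> q1; have m0 := @measurable_complex0 R.
pose q := fine (Pr (A 0%N @^-1` [set 0%R])).
have qE : Pr (A 0%N @^-1` [set 0%R]) = q%:E.
  by rewrite fineK// fin_num_measure//; exact: measurable_preimage_RV.
have q01 : (`|q| < 1)%R.
  rewrite ger0_norm; last by rewrite fine_ge0.
  by rewrite -lte_fin -qE.
pose N := \bigcap_k (A k.+1 @^-1` [set 0%R]).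
have mN : measurable N.
  by apply: bigcap_measurable => // k _; exact: measurable_preimage_RV.
exists N; split => //.
  have Nn n : Pr N <= (q ^+ n)%:E.
    have := iidA.1 (index_iota 1 n.+1) (fun=> [set 0%R]) (iota_uniq _ _) (fun=> m0).
    rewrite (eq_bigr (fun=> q%:E)); last by move=> k _; rewrite iid_prob.
    rewrite prodEFin prodr_const_nat subn1 => <-.
    apply: le_measure; rewrite ?inE//.
      by apply: bigcap_measurableType => k _; exact: measurable_preimage_RV.
    move=> w Nw k /=; rewrite mem_index_iota => /andP[k1 _].
    by have := Nw k.-1 I; rewrite prednK.
  apply/eqP; rewrite eq_le measure_ge0 andbT.
  have NE : Pr N = (fine (Pr N))%:E by rewrite fineK// fin_num_measure.
  rewrite NE lee_fin -(cvg_lim _ (cvg_expr q01))//.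
  apply: limr_ge; first by apply/cvg_ex; eexists; exact: cvg_expr.
  by apply: nearW => n; rewrite -lee_fin -NE.
move=> w /= nw k _ /=; apply: contrapT => Akw; apply: nw; exists k.
exact/eqP.
Qed.

End iid_coefficients.

(** * The almost sure limit of the ratio as a positive random variable *)

Section almost_sure_limit.
Context d (T : measurableType d) (R : realType) (Pr : probability T R).
Variable A : nat -> {RV Pr >-> R[i]}.

Lemma measurable_norm_ratio_RV p (r : R) n : (0 < p)%E -> 0 < r ->
  measurable_fun setT (fun w => norm_ratio p r (random_poly A n w)).
Proof.
move=> p0 r0; apply: measurable_norm_ratio => // k.
  exact: (measurableT_comp (@measurable_Re R) (measurable_funPT (A k))).
exact: (measurableT_comp (@measurable_Im R) (measurable_funPT (A k))).
Qed.

Lemma norm_ratio_ae_cvg p (r : R) : (0 < p)%E -> 0 < r < 1 -> iid A ->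
  (Pr [set w | A 0%N w = 0%R] < 1)%E ->
  ('E_Pr[fun w => log_plus (cabs (A 0%N w))] < +oo)%E ->
  {ae Pr, forall w, exists2 l : R, 0 < l &
    norm_ratio p r (random_poly A n w) @[n --> \oo] --> l}.
Proof.
move=> p0 /andP[r0 r1] iidA A0 Elog.
(* Any value strictly between [r] and 1 would do: with growth rate ln(rho/r), eventually |A_k| <=
   (rho/r)^k, that is |A_k| r^k <= rho^k. *)
pose rho := (1 + r) / 2.
have rho_gt : r < rho by rewrite /rho; lra.
have rho_lt : rho < 1 by rewrite /rho; lra.
have e0 : 0 < ln (rho / r) by rewrite ln_gt0// ltr_pdivlMr// mul1r.
have := ae_coef_growth iidA e0 Elog.
apply: filterS2 (ae_coef_neq0 iidA A0) => w exk [N _ grow].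
have rr : 0 < rho / r by rewrite divr_gt0// (lt_trans r0).
have [B HB] : exists B, forall n,
    \sum_(0 <= k < n) cabs (A k.+1 w) *+ k.+1 * r ^+ k <= B.
  apply: (@deriv_series_bounded R (fun k => cabs (A k w)) r rho N) => //.
  - by rewrite rho_lt ltW// (lt_trans r0).
  - by move=> k; exact: cabs_ge0.
  move=> k /grow/= Ak.
  have := le_expR_log_plus (cabs_ge0 _) Ak.
  rewrite mulrC expRM_natl lnK ?posrE// => H.
  apply: le_trans (ler_wpM2r _ H) _; first by rewrite exprn_ge0// ltW.
  by rewrite -exprMn divfK// gt_eqF.
exact: (norm_ratio_cvg p0 r0 HB exk).
Qed.

(** The upper limit is measurable and defined everywhere; replacing it by 1 where its real value is
    not positive makes [X] positive at every point, and changes nothing where a positive limit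
    exists. *)
Lemma ae_limit_RV (f : nat -> T -> R) :
  (forall n, measurable_fun setT (f n)) ->
  {ae Pr, forall w, exists2 l : R, 0 < l & f n w @[n --> \oo] --> l} ->
  exists X : {RV Pr >-> R}, (forall w, 0 < X w) /\
    {ae Pr, forall w, f n w @[n --> \oo] --> X w}.
Proof.
move=> mf fl; pose L w := fine (limn_esup (fun n => (f n w)%:E)).
have mL : measurable_fun setT L.
  have h : measurable_fun setT (fun w => limn_esup (fun n => (f n w)%:E)).
    by apply: measurable_fun_limn_esup => n; exact/measurable_EFinP.
  exact: (measurableT_comp (@fine_measurable R setT measurableT) h).
pose X w := if 0 < L w then L w else 1.
have mX : measurable_fun setT X.
  apply: measurable_fun_ifT => //.
  by apply: measurable_fun_ltr => //; exact: measurable_cst.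
exists (mfun_Sub (mem_set mX)); split.
  by move=> w /=; rewrite /X; case: ifPn.
apply: filterS fl => w [l l0 fwl] /=.
have fwE : (f n w)%:E @[n --> \oo] --> l%:E by apply: cvg_EFin => //; exact: nearW.
have LE : L w = l by rewrite /L (cvg_limn_einf_sup fwE).2.
by rewrite /X LE l0.
Qed.

End almost_sure_limit.

(** * Uniform bound on the expected ratio *)

Section moment_bounds.
Context d (T : measurableType d) (R : realType) (Pr : probability T R).
Variable A : nat -> {RV Pr >-> R[i]}.
Hypothesis iidA : iid A.

(** The disc of radius 1/m, written without division so that [m = 0] gives the whole plane. *)
Local Notation small m := [set z : R[i] | m%:R * cabs z <= 1].

Lemma measurable_small m : measurable (small m).
Proof.
have mf : measurable_fun setT (fun z : R[i] => m%:R * cabs z).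
  by apply: measurable_funM; [exact: measurable_cst|exact: measurable_cabs].
have -> : small m = setT `&` (fun z => m%:R * cabs z) @^-1` `]-oo, 1]%classic.
  by rewrite setTI; apply/seteqP; split=> z /=; rewrite in_itv.
exact: mf.
Qed.

Lemma prob_fineE (B : set T) : measurable B -> Pr B = (fine (Pr B))%:E.
Proof. by move=> mB; rewrite fineK// fin_num_measure. Qed.

Lemma small_ball_prob (e : R) : 0 < e ->
  ac_bounded_density_on (pushforward Pr (fun w => cabs (A 0%N w))) e ->
  exists2 C : R, 0 <= C & forall m,
    fine (Pr (A 0%N @^-1` small m.+1)) <= C / m.+1%:R.
Proof.
move=> e0 [f [mf f0 [M fM] Pf]].
have e0i : 0 \in `[0, e] by rewrite in_itv/= lexx ltW.
have M0 : 0 <= M := le_trans (f0 _ e0i) (fM _ e0i).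
(* The term [M] serves radii up to [e], where the density bound applies; for larger radii [e^-1]
   already makes the bound at least 1. *)
exists (M + e^-1); first by rewrite addr_ge0// invr_ge0 ltW.
move=> m; have ms : measurable (A 0%N @^-1` small m.+1).
  exact: measurable_preimage_RV (measurable_small _).
rewrite -lee_fin -prob_fineE//; set x := m.+1%:R^-1 : R.
have x0 : 0 < x by rewrite invr_gt0.
have [xe|ex] := leP x e; last first.
  apply: le_trans (probability_le1 Pr ms) _; rewrite lee_fin -/x mulrDl.
  rewrite -[leLHS]add0r; apply: lerD; first by rewrite mulr_ge0// ltW.
  by rewrite ler_pdivlMl// mulr1 ltW.
have -> : A 0%N @^-1` small m.+1 = (fun w => cabs (A 0%N w)) @^-1` `[0, x]%classic.
  apply/seteqP; split=> w /=; rewrite in_itv/= cabs_ge0/=.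
    by rewrite -ler_pdivlMl// mulr1.
  by rewrite -[_ * _ <= _]ler_pdivlMl// mulr1.
pose B := (`[0, x]%classic : set R).
have sub : B `<=` `[0, e]%classic by apply: subset_itvl; rewrite bnd_simp.
have -> : Pr ((fun w => cabs (A 0%N w)) @^-1` `[0, x]%classic) =
    (\int[@lebesgue_measure R]_(t in B) (f t)%:E)%E.
  by apply: Pf => //; exact: measurable_itv.
apply: (@le_trans _ _ (\int[@lebesgue_measure R]_(t in B) M%:E)%E).
  apply: ge0_le_integral => //.
  - exact: measurable_itv.
  - by move=> t tB; rewrite lee_fin f0//; exact: sub.
  - by apply/measurable_EFinP; exact: measurable_funS mf.
  - by move=> t tB; rewrite lee_fin fM//; exact: sub.
rewrite integral_cst; last exact: measurable_itv.
have muB : @lebesgue_measure R B = x%:E.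
  by rewrite /B lebesgue_measure_itv/= lte_fin x0 -EFinD subr0.
rewrite [X in (_ * X)%E](_ : _ = x%:E); last exact: muB.
rewrite -EFinM.
by rewrite lee_fin -/x ler_wpM2r ?(ltW x0)// lerDl invr_ge0 ltW.
Qed.

(** The subtracted term makes the induction telescope, since 1/(n+1)^2 <= 2/(n+1) - 2/(n+2). *)
Lemma sum_small_sq_le (C : R) (b : nat -> R) n : b 0%N <= 1 ->
  (forall m, b m.+1 <= (C / m.+1%:R) ^+ 2) ->
  \sum_(0 <= m < n.+1) b m <= 1 + 2 * C ^+ 2 - 2 * C ^+ 2 / n.+1%:R.
Proof.
move=> b0 bC; elim: n => [|n IH].
  by rewrite big_nat1 divr1 addrK.
rewrite big_nat_recr//=; apply: le_trans (lerD IH (bC n)) _.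
rewrite -addrA lerD2l -subr_ge0.
have n1 : (n.+1%:R : R) != 0 by rewrite pnatr_eq0.
have n2 : (n.+2%:R : R) != 0 by rewrite pnatr_eq0.
have -> : - (2 * C ^+ 2 / n.+2%:R) - (- (2 * C ^+ 2 / n.+1%:R) + (C / n.+1%:R) ^+ 2)
    = C ^+ 2 * n%:R / (n.+1%:R ^+ 2 * n.+2%:R).
  have E1 : (n.+1%:R : R) = n%:R + 1 by rewrite -natr1.
  have E2 : (n.+2%:R : R) = n%:R + 2 by rewrite -natr1 E1 -addrA.
  rewrite E2 E1 in n1 n2 *; field.
  by rewrite n1 n2.
by apply: divr_ge0; apply: mulr_ge0 => //; exact: sqr_ge0.
Qed.

Local Notation level_prob j := (fine (Pr [set w | j%:R < cabs (A 0%N w)])).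
Local Notation small_prob m := (fine (Pr (A 0%N @^-1` small m))).
Local Notation inv_max := (fun w => (Num.max (cabs (A 0%N w)) (cabs (A 1%N w)))^-1).

Lemma measurable_inv_max : measurable_fun setT inv_max.
Proof.
have h : measurable_fun setT (fun w => Num.max (cabs (A 0%N w)) (cabs (A 1%N w))).
  by apply: measurable_maxr; exact: measurable_cabs_RV.
have e w : inv_max w = Num.max (cabs (A 0%N w)) (cabs (A 1%N w)) `^ (-1).
  by rewrite powR_inv1// le_max cabs_ge0.
under eq_fun do rewrite e.
exact: measurable_powR_comp.
Qed.

Lemma inv_max_ge0 w : 0 <= inv_max w.
Proof. by rewrite invr_ge0 le_max cabs_ge0. Qed.

(** If the inverse of the maximum exceeds [m], both |A_0| and |A_1| are small; the index [k.+2]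
    differs from 0 and 1, so independence of three variables gives the product with a squared
    factor. *)
Lemma joint_level_prob_le k j m :
  (Pr ([set w | (j%:R < cabs (A k.+2 w))%R] `&` [set w | (m%:R < inv_max w)%R]) <=
    (level_prob j * small_prob m ^+ 2)%:E)%E.
Proof.
pose L := [set z : R[i] | j%:R < cabs z].
have mL : measurable L by exact: (measurable_level _ (@measurable_cabs R)).
pose B i := if (i < 2)%N then small m else L.
have mB i : measurable (B i).
  by rewrite /B; case: ifP => // _; exact: measurable_small.
have := iidA.1 [:: k.+2; 0%N; 1%N] B isT mB.
rewrite !big_cons big_nil mule1 /B/= !(iid_prob iidA)//; last 2 first.
- exact: measurable_small.
- exact: measurable_small.
rewrite [Pr (A 0%N @^-1` L)]prob_fineE; last exact: (measurable_preimage_RV _ _ mL).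
rewrite [Pr (A 0%N @^-1` small m)]prob_fineE; last first.
  exact: measurable_preimage_RV (measurable_small _).
rewrite -!EFinM -expr2 => <-.
apply: le_measure; rewrite ?inE.
- apply: measurableI; first exact: (measurable_preimage_RV _ _ mL).
  exact: (measurable_level _ measurable_inv_max).
- apply: bigcap_measurableType => i _; exact: measurable_preimage_RV (mB i).
move=> w [/= jA mZ] i.
have H : m%:R * Num.max (cabs (A 0%N w)) (cabs (A 1%N w)) <= 1.
  set x := Num.max _ _ in mZ *.
  have : 0 <= x by rewrite le_max cabs_ge0.
  rewrite le_eqVlt => /predU1P[<-|x0]; first by rewrite mulr0.
  by rewrite -ler_pdivlMr// mul1r ltW.
rewrite /= !inE => /or3P[] /eqP -> //=; apply: le_trans H.
  by rewrite ler_wpM2l// le_max lexx.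
by rewrite ler_wpM2l// le_max lexx orbT.
Qed.

(** The bound is a product of two sums free of [k]: the tails of |A_0|, summable by the finite mean,
    and the squared small-ball probabilities, of order 1/m^2. *)
Lemma mul_inv_max_bounded (e : R) : 0 < e ->
  ('E_Pr[fun w => cabs (A 0%N w)] < +oo)%E ->
  ac_bounded_density_on (pushforward Pr (fun w => cabs (A 0%N w))) e ->
  exists2 D : R, 0 <= D & forall k,
    (\int[Pr]_w (cabs (A k.+2 w) * inv_max w)%:E <= D%:E)%E.
Proof.
move=> e0 EA /(small_ball_prob e0)[C C0 HC].
have pf0 (B : set T) : 0 <= fine (Pr B) by rewrite fine_ge0.
pose b m := small_prob m ^+ 2.
have b0 m : 0 <= b m by rewrite sqr_ge0.
have sb : (\sum_(m <oo) (b m)%:E <= (1 + 2 * C ^+ 2)%:E)%E.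
  apply: lime_le; first by apply: is_cvg_nneseries => m _ _; rewrite lee_fin.
  apply: nearW => n; rewrite sumEFin lee_fin.
  apply: (@le_trans _ _ (\sum_(0 <= m < n.+1) b m)).
    by rewrite big_nat_recr//= lerDl.
  apply: le_trans (@sum_small_sq_le C b n _ _) _.
  - rewrite /b expr_le1// -lee_fin -prob_fineE ?probability_le1//.
      exact: measurable_preimage_RV (measurable_small _).
    exact: measurable_preimage_RV (measurable_small _).
  - by move=> m; rewrite lerXn2r ?nnegrE ?HC// divr_ge0.
  by rewrite gerBl divr_ge0// mulr_ge0// sqr_ge0.
have sb0 : (0 <= \sum_(m <oo) (b m)%:E)%E.
  by apply: nneseries_ge0 => m _ _; rewrite lee_fin.
have bfin : (\sum_(m <oo) (b m)%:E)%E \is a fin_num.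
  by rewrite ge0_fin_numE// (le_lt_trans sb)// ltry.
have mc0 := measurable_cabs_RV A 0.
have sa : (\sum_(j <oo) (level_prob j)%:E < +oo)%E.
  have -> : (fun n => \sum_(0 <= j < n) (level_prob j)%:E)%E =
      (fun n => \sum_(0 <= j < n) Pr [set w | (j%:R < cabs (A 0%N w))%R])%E.
    apply/funext => n; apply: eq_bigr => j _; rewrite -prob_fineE//.
    exact: measurable_level.
  apply: le_lt_trans (sum_level_prob_le Pr mc0 (fun w => cabs_ge0 _)) _.
  by rewrite lte_add_pinfty ?ltry.
have sa0 : (0 <= \sum_(j <oo) (level_prob j)%:E)%E.
  by apply: nneseries_ge0 => m _ _; rewrite lee_fin.
have afin : (\sum_(j <oo) (level_prob j)%:E)%E \is a fin_num.
  by rewrite ge0_fin_numE.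
exists (fine (\sum_(j <oo) (level_prob j)%:E)%E * fine (\sum_(m <oo) (b m)%:E)%E).
  by rewrite mulr_ge0// fine_ge0.
move=> k; rewrite EFinM !fineK//.
apply: integral_mul_le => //.
- exact: measurable_cabs_RV.
- exact: measurable_inv_max.
- by move=> w; exact: cabs_ge0.
- exact: inv_max_ge0.
- exact: joint_level_prob_le.
Qed.

(** The event A_0 = 0 lies in every small-ball event, whose probabilities are at most C/(n+1). *)
Lemma ae_coef0_neq0 (e : R) : 0 < e ->
  ac_bounded_density_on (pushforward Pr (fun w => cabs (A 0%N w))) e ->
  {ae Pr, forall w, A 0%N w != 0}.
Proof.
move=> e0 /(small_ball_prob e0)[C C0 HC].
exists (A 0%N @^-1` [set 0]); split.
- exact: measurable_preimage_RV (@measurable_complex0 R).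
- apply/eqP; rewrite eq_le measure_ge0 andbT.
  rewrite prob_fineE; last exact: measurable_preimage_RV (@measurable_complex0 R).
  have cC : C / n.+1%:R @[n --> \oo] --> C * 0.
    by apply: cvgMl_tmp; exact: cvg_harmonic.
  rewrite lee_fin -(mulr0 C) -(cvg_lim _ cC)//.
  apply: limr_ge; first by apply/cvg_ex; eexists; exact: cC.
  apply: nearW => n; apply: le_trans (HC n).
  rewrite -lee_fin -!prob_fineE.
  + apply: le_measure; rewrite ?inE.
    * exact: measurable_preimage_RV (@measurable_complex0 R).
    * exact: measurable_preimage_RV (measurable_small _).
    * by move=> w /= ->; rewrite cabs0 mulr0.
  + exact: measurable_preimage_RV (measurable_small _).
  + exact: measurable_preimage_RV (@measurable_complex0 R).
by move=> w /=; apply: contra_notP => /eqP.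
Qed.

(** The norm is at least |A_0| and at least r |A_1| / C, so the maximum of |A_0| and |A_1| is at
    most 1 + C/r times the norm; the numerator is bounded termwise. *)
Lemma norm_ratio_le_sum p (r : R) : (0 < p)%E -> 0 < r ->
  exists2 K : R, 0 <= K & forall n w, A 0%N w != 0 ->
    norm_ratio p r (random_poly A n w) <=
    K * \sum_(0 <= k < n) k.+1%:R * r ^+ k * (cabs (A k.+1 w) * inv_max w).
Proof.
move=> p0 r0; have [C C0 HC] := @circle_norm_coef1_ge R p p0.
exists (1 + C / r); first by rewrite addr_ge0// divr_ge0// ltW.
move=> n w A0.
rewrite norm_ratioE// /random_poly (deriv_polyE (fun k => A k w)).
(* For [n = 0] the coefficient A_1 is absent from the polynomial, but the derivative is zero. *)
case: n => [|n].
  by rewrite big_nil mulr0 poly_def big_ord0 circle_norm0// mul0r.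
set N := circle_norm p r (\poly_(k < n.+2) A k w).
set mx := Num.max (cabs (A 0%N w)) (cabs (A 1%N w)).
have N0 : cabs (A 0%N w) <= N.
  have := @circle_norm_horner0 R p r (\poly_(k < n.+2) A k w) p0 r0.
  by rewrite horner_coef0 coef_poly.
have N1 : cabs (A 1%N w) * r <= C * N.
  by have := HC r (\poly_(k < n.+2) A k w) r0; rewrite coef_poly.
have mx0 : 0 < mx by rewrite lt_max cabs_gt0 A0.
have Npos : 0 < N by apply: lt_le_trans N0; rewrite cabs_gt0.
have mxN : mx <= (1 + C / r) * N.
  rewrite mulrDl mul1r ge_max; apply/andP; split.
    by apply: le_trans N0 _; rewrite lerDl mulr_ge0 ?divr_ge0 ?(ltW C0) ?(ltW r0) ?(ltW Npos).
  apply: (@le_trans _ _ (C / r * N)); last by rewrite lerDr ltW.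
  by rewrite mulrAC ler_pdivlMr.
have NV : N^-1 <= (1 + C / r) * mx^-1.
  by rewrite ler_pdivlMr// ler_pdivrMl// mulrC.
rewrite -/N; apply: (@le_trans _ _ (\sum_(0 <= k < n.+1)
    cabs (A k.+1 w *+ k.+1) * r ^+ k * ((1 + C / r) * mx^-1))).
  rewrite -mulr_suml; apply: ler_pM => //.
  - exact: circle_norm_ge0.
  - by rewrite invr_ge0 ltW.
  exact: circle_norm_poly_le.
rewrite mulr_sumr le_eqVlt; apply/orP; left; apply/eqP.
apply: eq_bigr => k _.
by rewrite -[A k.+1 w *+ k.+1]mulr_natr cabsM cabs_nat -/mx; ring.
Qed.

Lemma norm_ratio_expectation_bounded p (r e : R) : (0 < p)%E -> 0 < r < 1 ->
  ('E_Pr[fun w => cabs (A 0%N w)] < +oo)%E -> 0 < e ->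
  ac_bounded_density_on (pushforward Pr (fun w => cabs (A 0%N w))) e ->
  exists M : R, forall n,
    ('E_Pr[fun w => norm_ratio p r (random_poly A n w)] <= M%:E)%E.
Proof.
move=> p0 /andP[r0 r1] EA e0 dens.
have [D D0 HD] := mul_inv_max_bounded e0 EA dens.
have [K K0 HK] := norm_ratio_le_sum p0 r0.
exists (K * ((1 - r) ^- 2 * (D + 1))) => n.
pose Y k w := cabs (A k.+1 w) * inv_max w.
have mY k : measurable_fun setT (Y k).
  by apply: measurable_funM; [exact: measurable_cabs_RV|exact: measurable_inv_max].
have Y0 k w : 0 <= Y k w by rewrite mulr_ge0 ?cabs_ge0 ?inv_max_ge0.
have HY k : (\int[Pr]_w (Y k w)%:E <= (D + 1)%:E)%E.
  (* The term with A_1 is not independent of the maximum, but its quotient by the maximum is at most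
     1; this accounts for [D + 1]. *)
  case: k => [|k]; last first.
    by apply: le_trans (HD k) _; rewrite lee_fin lerDl.
  apply: (@le_trans _ _ (\int[Pr]_w (cst 1 w)%E)%E).
    apply: ge0_le_integral => //.
    - by move=> w _; rewrite lee_fin.
    - exact/measurable_EFinP.
    move=> w _; rewrite lee_fin /Y.
    set x := Num.max _ _; have : 0 <= x by rewrite le_max cabs_ge0.
    rewrite le_eqVlt => /predU1P[<-|x0]; first by rewrite invr0 mulr0.
    by rewrite ler_pdivrMr// mul1r le_max lexx orbT.
  rewrite integral_cst// [X in (1 * X)%E](probability_setT Pr) mule1 lee_fin.
  by rewrite lerDr.
have c0 k : 0 <= k.+1%:R * r ^+ k by rewrite mulr_ge0// exprn_ge0// ltW.
have -> : 'E_Pr[fun w => norm_ratio p r (random_poly A n w)]%E =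
    (\int[Pr]_w (norm_ratio p r (random_poly A n w))%:E)%E by rewrite unlock.
apply: (@le_trans _ _ (\int[Pr]_w (K%:E *
    \sum_(0 <= k < n) ((k.+1%:R * r ^+ k)%:E * (Y k w)%:E)))%E).
  (* The pointwise bound needs A_0 nonzero, so the comparison is almost everywhere. *)
  apply: ae_ge0_le_integral => //.
  - move=> w _; rewrite lee_fin norm_ratioE// divr_ge0 ?circle_norm_ge0//.
  - by apply/measurable_EFinP; exact: measurable_norm_ratio_RV.
  - by move=> w _; rewrite mule_ge0// sume_ge0// => k _; rewrite mule_ge0// lee_fin.
  - apply: emeasurable_funM; first exact: measurable_cst.
    apply: emeasurable_sum => k; apply: emeasurable_funM; first exact: measurable_cst.
    exact/measurable_EFinP.
  apply: filterS (ae_coef0_neq0 e0 dens) => w A0 _.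
  under eq_bigr do rewrite -EFinM.
  by rewrite sumEFin -EFinM lee_fin; exact: HK.
rewrite ge0_integralZl_EFin//; last 2 first.
- by move=> w _; rewrite sume_ge0// => k _; rewrite mule_ge0// lee_fin.
- apply: emeasurable_sum => k; apply: emeasurable_funM; first exact: measurable_cst.
  exact/measurable_EFinP.
rewrite EFinM; apply: lee_wpmul2l; first by rewrite lee_fin.
rewrite ge0_integral_sum//; last 2 first.
- by move=> k; apply: emeasurable_funM; [exact: measurable_cst|exact/measurable_EFinP].
- by move=> k w _; rewrite mule_ge0// lee_fin.
apply: (@le_trans _ _ (\sum_(0 <= k < n) (k.+1%:R * r ^+ k * (D + 1))%:E)%E).
  apply: lee_sum => k _; rewrite ge0_integralZl_EFin//.
  - rewrite [leRHS]EFinM; apply: lee_wpmul2l; [by rewrite lee_fin|exact: HY].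
  - by move=> w _; rewrite lee_fin.
  - exact/measurable_EFinP.
rewrite sumEFin lee_fin -mulr_suml ler_wpM2r ?addr_ge0//.
by rewrite sum_succ_geom_le// r1 ltW.
Qed.

End moment_bounds.

Theorem theorem3 (R : realType) (d : measure_display) (T : measurableType d)
    (Pr : probability T R) (p : \bar R) (r : R)
    (A : nat -> {RV Pr >-> R[i]}) :
  (0 < p)%E -> 0 < r < 1 ->
  iid A ->
  (Pr [set w | A 0%N w = 0%R] < 1)%E ->
  (('E_Pr[fun w => log_plus (cabs (A 0%N w))] < +oo)%E ->
     exists X : {RV Pr >-> R},
       (forall w, 0 < X w) /\
       {ae Pr, forall w, norm_ratio p r (random_poly A n w) @[n --> \oo] --> X w})
  /\
  (('E_Pr[fun w => cabs (A 0%N w)] < +oo)%E ->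
   (exists2 e : R, 0 < e &
      ac_bounded_density_on (pushforward Pr (fun w => cabs (A 0%N w))) e) ->
     (ereal_sup (range (fun n : nat =>
        'E_Pr[fun w => norm_ratio p r (random_poly A n w)])) < +oo)%E).
Proof.
move=> p0 r01 iidA A0; have /andP[r0 _] := r01; split=> [EA|EA [e e0 dens]].
  apply: ae_limit_RV; last exact: norm_ratio_ae_cvg.
  by move=> n; exact: measurable_norm_ratio_RV.
have [M HM] := norm_ratio_expectation_bounded iidA p0 r01 EA e0 dens.
apply: (@le_lt_trans _ _ M%:E); last exact: ltry.
by apply: ge_ereal_sup => _ [n _ <-]; exact: HM.
Qed.
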